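(* Let $Q$ be a strongly locally finite quiver, $k$ a field, and let $M$ be an indecomposable representation in $\mathrm{rep}(Q)$. (1) If $M\in\mathrm{rep}^+(Q)$ is not projective, then $\mathrm{rep}(Q)$ has an almost split sequence $0\to \mathrm{DTr}\,M\to N\to M\to0$, where $\mathrm{DTr}\,M\in\mathrm{rep}^-(Q)$. (2) If $M\in\mathrm{rep}^-(Q)$ is not injective, then $\mathrm{rep}(Q)$ has an almost split sequence $0\to M\to N\to\mathrm{TrD}\,M\to0$, where $\mathrm{TrD}\,M\in\mathrm{rep}^+(Q)$.
   Context: A quiver $Q=(Q_0,Q_1)$ is locally finite if every vertex is the starting point of finitely many arrows and the ending point of finitely many arrows; interval-finite if for all $x,y\in Q_0$ the set $Q(x,y)$ of paths from $x$ to $y$ (including trivial paths) is finite; strongly locally finite if both. $\mathrm{rep}(Q)$ is the abelian category of locally finite dimensional $k$-representations $M$ of $Q$ (each $M(x)$ finite dimensional). For $a\in Q_0$: $P_a(x)$ has basis $Q(a,x)$, an arrow $\alpha$ acting by $\rho\mapsto\alpha\rho$; $I_a(x)$ has basis $Q(x,a)$, where $I_a(\alpha)$ sends $\rho\alpha$ to $\rho$ and vanishes on paths not factoring through $\alpha$. $\mathrm{proj}(Q)$ (respectively $\mathrm{inj}(Q)$) is the category of representations isomorphic to finite direct sums of representations $P_a$ (respectively $I_a$), $a\in Q_0$. $\mathrm{rep}^+(Q)$ is the category of finitely presented representations: those $M$ with an exact sequence $0\to P_1\to P_0\to M\to0$, $P_0,P_1\in\mathrm{proj}(Q)$. $\mathrm{rep}^-(Q)$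 is the category of finitely co-presented representations: those $M$ with an exact sequence $0\to M\to I_0\to I_1\to0$, $I_0,I_1\in\mathrm{inj}(Q)$. Let $A=kQ$ be the path algebra; representations $M$ of $Q$ are identified with left unitary $A$-modules $\bigoplus_xM(x)$, and right unitary $A$-modules with representations of the opposite quiver $Q^{\mathrm{op}}$. $D$ denotes the vertexwise $k$-duality between $\mathrm{rep}(Q)$ and $\mathrm{rep}(Q^{\mathrm{op}})$. The Nakayama functor $\nu=D\,\mathrm{Hom}_A(-,A):\mathrm{proj}(Q)\to\mathrm{inj}(Q)$ is an equivalence with $\nu(P_x)\cong I_x$ and quasi-inverse $\nu^-=\mathrm{Hom}_{A^{\mathrm{op}}}(D-,A^{\mathrm{op}})$. If $M$ has a minimal projective resolution $0\to P_1\xrightarrow{f}P_0\to M\to0$ with $P_0,P_1\in\mathrm{proj}(Q)$, then $\mathrm{DTr}\,M$ is the kernel of $\nu(f):\nu(P_1)\to\nu(P_0)$. If $M$ has a minimal injective co-resolution $0\to M\to I_0\xrightarrow{g}I_1\to0$ with $I_0,I_1\in\mathrm{inj}(Q)$, then $\mathrm{TrD}\,M$ is the cokernel of $\nu^-(g):\nu^-(I_0)\to\nu^-(I_1)$. Both are defined up to isomorphism. A morphism $f:X\to Y$ is right minimal if every $h:X\to X$ with $fh=f$ is an automorphism; right almost split if $f$ is not a retraction and every non-retraction $g:Z\to Y$ factors through $f$; minimal right almost split if both. Left minimal, left almost split and minimal left almost split are the dual notions. An almost split sequence in an abelian category is a short exact sequence $0\to X\xrightarrow{f}Y\xrightarrow{g}Z\to0$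 with $f$ minimal left almost split and $g$ minimal right almost split. *)

(* Defs.v *)
From HB Require Import structures.
From mathcomp Require Import all_boot all_order all_algebra.
From mathcomp Require Import boolp classical_sets cardinality.
From mathcomp Require Import freeg.

Set Implicit Arguments.
Unset Strict Implicit.
Unset Printing Implicit Defensive.

Import GRing.Theory.
Local Open Scope ring_scope.
#[local] Obligation Tactic := idtac.

Section LinearMaps.
Context (k : fieldType).
Implicit Types U V : lmodType k.

Definition mklin U V (f : U -> V) (H : linear f) : {linear U -> V} :=
  HB.pack f (GRing.isLinear.Build k U V *:%R f H).

Lemma linear_ext U V (f g : {linear U -> V}) : f =1 g -> f = g.
Proof.
case: f g => [f cf] [g cg] /= /funext fg; case: _ / fg cg => cg.
congr (GRing.Linear.Pack _).
by case: cf cg => [[a] [b]] [[a'] [b']]; congr GRing.Linear.Class; congr (_ _);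
  apply: Prop_irrelevance.
Qed.

Lemma fglift_linear (K : choiceType) V (f : K -> V) :
  linear (fglift f : {freeg K / k} -> V).
Proof.
have fB : additive (fglift f : {freeg K / k} -> V) by exact: lift_is_additive.
pose F : {additive {freeg K / k} -> V} :=
  HB.pack (fglift f : {freeg K / k} -> V) (GRing.isAdditive.Build _ _ _ fB).
have FE D : F D = \sum_(x <- dom D) coeff x D *: f x.
  rewrite -{1}(freeg_sumE D) (raddf_sum F).
  by apply: eq_bigr => x _; rewrite /= liftU.
have FZ c D : F (c *: D) = c *: F D.
  rewrite (FE D) -{1}(freeg_sumE D) !scaler_sumr (raddf_sum F).
  apply: eq_bigr => x _.
  have -> : c *: << coeff x D *g x >> = << c * coeff x D *g x >>
    :> {freeg K / k}.
    by apply/eqP/freeg_eqP => y; rewrite coeffZ !coeffU mulrA.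
  by rewrite /= liftU scalerA.
by move=> c D E; rewrite -[fglift f _]/(F _) raddfD FZ.
Qed.

Definition linear_extension (K : choiceType) V (f : K -> V) :
  {linear {freeg K / k} -> V} := mklin (fglift_linear f).

Lemma linear_extensionU (K : choiceType) V (f : K -> V) (x : K) :
  linear_extension f << x >> = f x.
Proof. by rewrite /= liftU scale1r. Qed.

Lemma freeg_linear_ext (K : choiceType) V (f g : {linear {freeg K / k} -> V}) :
  (forall x : K, f << x >> = g << x >>) -> f =1 g.
Proof.
move=> fg D; rewrite -(freeg_sumE D) !linear_sum; apply: eq_bigr => x _.
have -> : << coeff x D *g x >> = coeff x D *: << x >> :> {freeg K / k}.
  by apply/eqP/freeg_eqP => y; rewrite coeffZ !coeffU mul1r.
by rewrite (linearZ_LR f) (linearZ_LR g) fg.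
Qed.

Definition kdual V := {linear V -> k^o}.

HB.instance Definition _ V := gen_eqMixin (kdual V).
HB.instance Definition _ V := gen_choiceMixin (kdual V).

Section DualModule.
Variable V : lmodType k.
Implicit Types f g h : kdual V.

Definition kdual_zero : kdual V := \0%R.
Definition kdual_opp f : kdual V := \- f.
Definition kdual_add f g : kdual V := f \+ g.
Definition kdual_scale (c : k) f : kdual V := c \*: f.

Lemma kdual_addA : associative kdual_add.
Proof. by move=> f g h; apply: linear_ext => v /=; rewrite addrA. Qed.
Lemma kdual_addC : commutative kdual_add.
Proof. by move=> f g; apply: linear_ext => v /=; rewrite addrC. Qed.
Lemma kdual_add0 : left_id kdual_zero kdual_add.
Proof. by move=> f; apply: linear_ext => v /=; rewrite add0r. Qed.
Lemma kdual_addN : left_inverse kdual_zero kdual_opp kdual_add.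
Proof. by move=> f; apply: linear_ext => v /=; rewrite addNr. Qed.

HB.instance Definition _ :=
  GRing.isZmodule.Build (kdual V) kdual_addA kdual_addC kdual_add0 kdual_addN.

Lemma kdual_scaleA c d f :
  kdual_scale c (kdual_scale d f) = kdual_scale (c * d) f.
Proof. by apply: linear_ext => v /=; rewrite scalerA. Qed.
Lemma kdual_scale1 : left_id 1 kdual_scale.
Proof. by move=> f; apply: linear_ext => v /=; rewrite scale1r. Qed.
Lemma kdual_scaleDr : right_distributive kdual_scale +%R.
Proof. by move=> c f g; apply: linear_ext => v /=; rewrite scalerDr. Qed.
Lemma kdual_scaleDl f : {morph kdual_scale^~ f : c d / c + d}.
Proof. by move=> c d; apply: linear_ext => v /=; rewrite scalerDl. Qed.

HB.instance Definition _ := GRing.Zmodule_isLmodule.Build k (kdual V)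
  kdual_scaleA kdual_scale1 kdual_scaleDr kdual_scaleDl.

End DualModule.

Lemma kdual_map_linear U V (f : {linear U -> V}) :
  linear (fun p : kdual V => p \o f : kdual U).
Proof. by move=> c p q; apply: linear_ext. Qed.

Definition kdual_map U V (f : {linear U -> V}) : {linear kdual V -> kdual U} :=
  mklin (kdual_map_linear f).

End LinearMaps.

(* The projections are primitive so that op (op Q) is convertible to Q.       *)
#[projections(primitive)]
Record quiver := Quiver {
  vertex :> Type;
  arrow : vertex -> vertex -> Type
}.

Definition op (Q : quiver) : quiver := Quiver (fun x y : Q => arrow y x).

(* qpath_post r a is the path "r followed by a", usually written a r.         *)
Inductive qpath (Q : quiver) (x : Q) : Q -> Type :=
| qpath_triv : qpath x x
| qpath_post (y z : Q) (r : qpath x y) (a : arrow y z) : qpath x z.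

(* qpath_pre a r is the path "a followed by r", usually written r a.          *)
Fixpoint qpath_pre (Q : quiver) (x y : Q) (a : arrow x y) (z : Q)
    (r : qpath y z) : qpath x z :=
  match r in qpath _ z return qpath x z with
  | qpath_triv => qpath_post (qpath_triv x) a
  | qpath_post _ _ s b => qpath_post (qpath_pre a s) b
  end.

HB.instance Definition _ (Q : quiver) (x y : Q) := gen_eqMixin (qpath x y).
HB.instance Definition _ (Q : quiver) (x y : Q) := gen_choiceMixin (qpath x y).

Definition locally_finite (Q : quiver) : Prop :=
  forall x : Q, finite_set [set: {y : Q & arrow x y}] /\
                finite_set [set: {y : Q & arrow y x}].

Definition interval_finite (Q : quiver) : Prop :=
  forall x y : Q, finite_set [set: qpath x y].

Definition strongly_locally_finite (Q : quiver) : Prop :=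
  locally_finite Q /\ interval_finite Q.

Record repn (k : fieldType) (Q : quiver) := Repn {
  space :> Q -> lmodType k;
  act : forall x y : Q, arrow x y -> {linear space x -> space y}
}.

Record rhom (k : fieldType) (Q : quiver) (M N : repn k Q) := RHom {
  rhom_at :> forall x : Q, {linear M x -> N x};
  rhom_act : forall (x y : Q) (a : arrow x y) (v : M x),
    rhom_at y (act M a v) = act N a (rhom_at x v)
}.

Lemma rhom_ext (k : fieldType) (Q : quiver) (M N : repn k Q) (f g : rhom M N) :
  (forall x, f x =1 g x) -> f = g.
Proof.
case: f g => [f Hf] [g Hg] /= fg.
have E : f = g.
  by apply: functional_extensionality_dep => x; exact: linear_ext (fg x).
by subst g; congr RHom; exact: Prop_irrelevance.
Qed.

HB.instance Definition _ (k : fieldType) (Q : quiver) (M N : repn k Q) :=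
  gen_eqMixin (rhom M N).
HB.instance Definition _ (k : fieldType) (Q : quiver) (M N : repn k Q) :=
  gen_choiceMixin (rhom M N).

Section HomModule.
Variables (k : fieldType) (Q : quiver) (M N : repn k Q).
Implicit Types f g h : rhom M N.

Program Definition rhom_zero : rhom M N := RHom (rhom_at := fun x => \0%R) _.
Next Obligation. by move=> x y a v /=; rewrite linear0. Qed.
Program Definition rhom_opp f : rhom M N := RHom (rhom_at := fun x => \- f x) _.
Next Obligation. by move=> f x y a v /=; rewrite rhom_act linearN. Qed.
Program Definition rhom_add f g : rhom M N :=
  RHom (rhom_at := fun x => f x \+ g x) _.
Next Obligation. by move=> f g x y a v /=; rewrite !rhom_act linearD. Qed.
Program Definition rhom_scale (c : k) f : rhom M N :=
  RHom (rhom_at := fun x => c \*: f x) _.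
Next Obligation. by move=> c f x y a v /=; rewrite rhom_act linearZ. Qed.

Lemma rhom_addA : associative rhom_add.
Proof. by move=> f g h; apply: rhom_ext => x v /=; rewrite addrA. Qed.
Lemma rhom_addC : commutative rhom_add.
Proof. by move=> f g; apply: rhom_ext => x v /=; rewrite addrC. Qed.
Lemma rhom_add0 : left_id rhom_zero rhom_add.
Proof. by move=> f; apply: rhom_ext => x v /=; rewrite add0r. Qed.
Lemma rhom_addN : left_inverse rhom_zero rhom_opp rhom_add.
Proof. by move=> f; apply: rhom_ext => x v /=; rewrite addNr. Qed.

HB.instance Definition _ :=
  GRing.isZmodule.Build (rhom M N) rhom_addA rhom_addC rhom_add0 rhom_addN.

Lemma rhom_scaleA c d f : rhom_scale c (rhom_scale d f) = rhom_scale (c * d) f.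
Proof. by apply: rhom_ext => x v /=; rewrite scalerA. Qed.
Lemma rhom_scale1 : left_id 1 rhom_scale.
Proof. by move=> f; apply: rhom_ext => x v /=; rewrite scale1r. Qed.
Lemma rhom_scaleDr : right_distributive rhom_scale +%R.
Proof. by move=> c f g; apply: rhom_ext => x v /=; rewrite scalerDr. Qed.
Lemma rhom_scaleDl f : {morph rhom_scale^~ f : c d / c + d}.
Proof. by move=> c d; apply: rhom_ext => x v /=; rewrite scalerDl. Qed.

HB.instance Definition _ := GRing.Zmodule_isLmodule.Build k (rhom M N)
  rhom_scaleA rhom_scale1 rhom_scaleDr rhom_scaleDl.

End HomModule.

Section Representations.
Context (k : fieldType) (Q : quiver).
Implicit Types M N L : repn k Q.

(* M is an object of rep(Q).                                                  *)
Definition lfd M : Prop :=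
  forall x : Q, exists n : nat, inhabited (Vector.axiom n (M x)).

Program Definition rid M : rhom M M := RHom (rhom_at := fun x => idfun) _.
Next Obligation. by []. Qed.

Program Definition rcomp M N L (g : rhom N L) (f : rhom M N) : rhom M L :=
  RHom (rhom_at := fun x => g x \o f x) _.
Next Obligation. by move=> M N L g f x y a v /=; rewrite !rhom_act. Qed.

Definition is_iso M N (f : rhom M N) : Prop :=
  exists g : rhom N M, rcomp g f = rid M /\ rcomp f g = rid N.

Definition isomorphic M N : Prop := exists f : rhom M N, is_iso f.

Definition rzero : repn k Q :=
  @Repn k Q (fun x => 'rV[k]_0) (fun x y a => idfun).

Definition is_zero M : Prop := forall (x : Q) (v : M x), v = 0.

Lemma rsum_act_linear M N (x y : Q) (a : arrow x y) :
  linear (fun v : M x * N x => (act M a v.1, act N a v.2)).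
Proof. by move=> c u v; congr (_, _); rewrite /= linearP. Qed.

Definition rsum M N : repn k Q :=
  @Repn k Q (fun x => (M x * N x)%type)
    (fun x y a => mklin (@rsum_act_linear M N x y a)).

Definition indecomposable M : Prop :=
  ~ is_zero M /\
  forall M1 M2, lfd M1 -> lfd M2 -> isomorphic M (rsum M1 M2) ->
    is_zero M1 \/ is_zero M2.

Definition is_mono M N (f : rhom M N) : Prop := forall x : Q, injective (f x).

Definition is_epi M N (f : rhom M N) : Prop :=
  forall (x : Q) (w : N x), exists v : M x, f x v = w.

Definition exact_at M N L (f : rhom M N) (g : rhom N L) : Prop :=
  forall (x : Q) (w : N x), g x w = 0 <-> exists v : M x, f x v = w.

Definition short_exact M N L (f : rhom M N) (g : rhom N L) : Prop :=
  [/\ is_mono f, exact_at f g & is_epi g].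

Definition is_kernel X M N (i : rhom X M) (g : rhom M N) : Prop :=
  is_mono i /\ exact_at i g.

Definition is_cokernel M N X (g : rhom M N) (q : rhom N X) : Prop :=
  exact_at g q /\ is_epi q.

Definition is_projective M : Prop :=
  forall X Y (p : rhom X Y) (f : rhom M Y), lfd X -> lfd Y -> is_epi p ->
    exists g : rhom M X, rcomp p g = f.

Definition is_injective M : Prop :=
  forall X Y (i : rhom X Y) (f : rhom X M), lfd X -> lfd Y -> is_mono i ->
    exists g : rhom Y M, rcomp g i = f.

Definition section_hom M N (f : rhom M N) : Prop :=
  exists r : rhom N M, rcomp r f = rid M.

Definition retraction M N (f : rhom M N) : Prop :=
  exists s : rhom N M, rcomp f s = rid N.

Definition right_minimal M N (f : rhom M N) : Prop :=
  forall h : rhom M M, rcomp f h = f -> is_iso h.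

Definition left_minimal M N (f : rhom M N) : Prop :=
  forall h : rhom N N, rcomp h f = f -> is_iso h.

Definition right_almost_split M N (f : rhom M N) : Prop :=
  ~ retraction f /\
  forall Z (g : rhom Z N), lfd Z -> ~ retraction g ->
    exists h : rhom Z M, rcomp f h = g.

Definition left_almost_split M N (f : rhom M N) : Prop :=
  ~ section_hom f /\
  forall Z (g : rhom M Z), lfd Z -> ~ section_hom g ->
    exists h : rhom N Z, rcomp h f = g.

Definition almost_split_sequence X Y Z (f : rhom X Y) (g : rhom Y Z) : Prop :=
  [/\ [/\ lfd X, lfd Y & lfd Z], short_exact f g,
      left_minimal f /\ left_almost_split f
    & right_minimal g /\ right_almost_split g].

Definition proj_rep (a : Q) : repn k Q :=
  @Repn k Q (fun x => {freeg (qpath a x) / k})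
    (fun x y b => linear_extension (fun r : qpath a x =>
       << qpath_post r b >> : {freeg (qpath a y) / k})).

(* Since qpath_pre b is injective, the path r below is unique.                *)
Definition qpath_cut (x y a : Q) (b : arrow x y) (s : qpath x a) :
    {freeg (qpath y a) / k} :=
  if pselect (exists r : qpath y a, qpath_pre b r = s) is left e
  then << projT1 (cid e) >> else 0.

Definition inj_rep (a : Q) : repn k Q :=
  @Repn k Q (fun x => {freeg (qpath x a) / k})
    (fun x y b => linear_extension (@qpath_cut x y a b)).

Definition in_proj M : Prop :=
  exists s : seq Q, isomorphic M (foldr (fun a => rsum (proj_rep a)) rzero s).

Definition in_inj M : Prop :=
  exists s : seq Q, isomorphic M (foldr (fun a => rsum (inj_rep a)) rzero s).

Definition in_rep_plus M : Prop :=
  exists P1 P0 (f : rhom P1 P0) (p : rhom P0 M),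
    [/\ in_proj P1, in_proj P0 & short_exact f p].

Definition in_rep_minus M : Prop :=
  exists I0 I1 (j : rhom M I0) (g : rhom I0 I1),
    [/\ in_inj I0, in_inj I1 & short_exact j g].

(* Essential epimorphisms and monomorphisms of rep(Q): projective covers and  *)
(* injective envelopes are those with projective source, respectively with    *)
(* injective target.                                                          *)
Definition essential_epi M N (p : rhom M N) : Prop :=
  is_epi p /\
  forall X (h : rhom X M), lfd X -> is_epi (rcomp p h) -> is_epi h.

Definition essential_mono M N (j : rhom M N) : Prop :=
  is_mono j /\
  forall X (h : rhom N X), lfd X -> is_mono (rcomp h j) -> is_mono h.

(* Minimality only has to be imposed at the augmentation: the other           *)
(* differential is an isomorphism onto the kernel, respectively induces an    *)
(* isomorphism from the cokernel.                                             *)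
Definition minimal_proj_resolution P1 P0 M (f : rhom P1 P0) (p : rhom P0 M) :
    Prop :=
  [/\ in_proj P1, in_proj P0, short_exact f p & essential_epi p].

Definition minimal_inj_coresolution M I0 I1 (j : rhom M I0) (g : rhom I0 I1) :
    Prop :=
  [/\ in_inj I0, in_inj I1, short_exact j g & essential_mono j].

(* Right multiplication by the arrow b on the path algebra A = kQ, restricted *)
(* to A e_y = P_y -> A e_x = P_x.                                             *)
Program Definition right_mult (x y : Q) (b : arrow x y) :
    rhom (proj_rep y) (proj_rep x) :=
  RHom (rhom_at := fun z => linear_extension (fun r : qpath y z =>
    << qpath_pre b r >> : {freeg (qpath x z) / k})) _.
Next Obligation.
move=> x y b z w a v.
pose pre u := linear_extension (fun r : qpath y u =>
  << qpath_pre b r >> : {freeg (qpath x u) / k}).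
pose post t := linear_extension (fun r : qpath t z =>
  << qpath_post r a >> : {freeg (qpath t w) / k}).
change ((pre w \o post y) v = (post x \o pre z) v).
apply: (freeg_linear_ext (f := pre w \o post y) (g := post x \o pre z)) => r.
by rewrite /pre /post /= !liftU !scale1r !liftU !scale1r.
Qed.

Lemma hom_right_mult_linear M (x y : Q) (b : arrow x y) :
  linear (fun h : rhom M (proj_rep y) => rcomp (right_mult b) h).
Proof.
by move=> c h h'; apply: rhom_ext => z v; exact: (linearP (right_mult b z)).
Qed.

(* The right A-module Hom_A(M, A) as a representation of op Q: its component  *)
(* at x is Hom_A(M, A) e_x = Hom_A(M, A e_x), where A e_x is P_x. These       *)
(* fill up the whole of Hom_A(M, A) when M is finitely generated.             *)
Definition hom_to_A M : repn k (op Q) :=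
  @Repn k (op Q) (fun x => rhom M (proj_rep x))
    (fun y x (b : @arrow Q x y) => mklin (@hom_right_mult_linear M x y b)).

Lemma precomp_linear M N L (f : rhom M N) :
  linear (fun h : rhom N L => rcomp h f).
Proof. by move=> c h h'; apply: rhom_ext. Qed.

Program Definition hom_to_A_map M N (f : rhom M N) :
    rhom (hom_to_A N) (hom_to_A M) :=
  @RHom k (op Q) (hom_to_A N) (hom_to_A M)
    (fun x => mklin (@precomp_linear M N (proj_rep x) f)) _.
Next Obligation. by move=> M N f x y b h; apply: rhom_ext. Qed.

Definition drep M : repn k (op Q) :=
  @Repn k (op Q) (fun x => kdual (M x))
    (fun y x (b : @arrow Q x y) => kdual_map (act M b)).

Program Definition drep_map M N (f : rhom M N) : rhom (drep N) (drep M) :=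
  @RHom k (op Q) (drep N) (drep M) (fun x => kdual_map (f x)) _.
Next Obligation.
by move=> M N f x y b p; apply: linear_ext => v /=; rewrite rhom_act.
Qed.

End Representations.

Section AuslanderReiten.
Context (k : fieldType) (Q : quiver).
Implicit Types M N X : repn k Q.

(* D Hom_A(M, A) and Hom_(A^op)(D M, A^op), with their actions on morphisms.  *)
Definition nakayama M : repn k Q := drep (hom_to_A M).

Definition nakayama_map M N (f : rhom M N) :
  rhom (nakayama M) (nakayama N) := drep_map (hom_to_A_map f).

Definition nakayama_inv M : repn k Q := @hom_to_A k (op Q) (drep M).

Definition nakayama_inv_map M N (f : rhom M N) :
    rhom (nakayama_inv M) (nakayama_inv N) :=
  @hom_to_A_map k (op Q) _ _ (drep_map f).

Definition is_DTr M X : Prop :=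
  exists P1 P0 (f : rhom P1 P0) (p : rhom P0 M) (i : rhom X (nakayama P1)),
    minimal_proj_resolution f p /\ is_kernel i (nakayama_map f).

Definition is_TrD M X : Prop :=
  exists I0 I1 (j : rhom M I0) (g : rhom I0 I1) (q : rhom (nakayama_inv I1) X),
    minimal_inj_coresolution j g /\ is_cokernel (nakayama_inv_map g) q.

End AuslanderReiten.

(* Main.v *)
(* For P in proj(Q) and any Z, a functional t on Hom(P, Z) defines a morphism  *)
(* u_t : Z -> nu P, u_t(z)(h) = t(zh), where z in Z(x) is read as P_x -> Z.    *)
(* This is a natural bijection D Hom(P, Z) = Hom(Z, nu P); with a minimal      *)
(* resolution f : P1 -> P0 of M it identifies Ext^1(Z, DTr M) with             *)
(* D Hom(M, Z). End(M) is local by Fitting's lemma, so there is a functional   *)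
(* on it that vanishes on the non-isomorphisms but not at the identity; extend *)
(* it to t on Hom(P0, M) and pull back nu f : nu P1 -> nu P0 along             *)
(* u_t : M -> nu P0. A morphism Z -> M lifts to the pullback N as soon as all  *)
(* composites M -> Z -> M are non-isomorphisms, so N -> M is right almost      *)
(* split. Exactness on the left uses Hom(M, P_x) = 0, which holds because      *)
(* rep(Q) is hereditary. An endomorphism of N over M restricts to DTr M, hence *)
(* lifts to nu P1 and nu P0 and, nu being fully faithful, induces an           *)
(* endomorphism of M; as the latter is invertible or nilpotent, the former is  *)
(* invertible. This gives minimality, and then the left-hand properties.       *)
(* Part (2) is part (1) for the opposite quiver, transported by D.             *)

From HB Require Import structures.
Require Import Defs.
From mathcomp Require Import all_boot all_order all_algebra.
From mathcomp Require Import boolp classical_sets cardinality.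
From mathcomp Require Import freeg.

Set Implicit Arguments.
Unset Strict Implicit.
Unset Printing Implicit Defensive.

Import GRing.Theory VectorInternalTheory.
Local Open Scope ring_scope.
#[local] Obligation Tactic := idtac.

(** Over proj(Q) everything rests on the natural bijection D Hom(P, Z) = Hom(Z, nu P), which is
    [nakayama_pairing] together with [nakayama_pairing_surj] and [nakayama_pairing_inj]. It turns
    questions about morphisms into nu P into linear algebra on finite-dimensional Hom spaces, and
    yields that nu is full and faithful ([nakayama_full], [nakayama_faithful]) and that nu P is
    injective ([nakayama_injective]).

    The sequence 0 -> DTr M -> nu P1 -> nu P0 -> 0 is exact by [nakayama_epi], which depends on
    [hereditary] through [hom_proj_zero]; as nu P lies in inj(Q) by [nakayama_in_inj], this puts DTr
    M in rep^-(Q). Pulling it back along the morphism M -> nu P0 given by the functional of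
    [local_functional] produces the almost split sequence in [DTr_almost_split]. Right minimality is
    [DTr_endo], and [almost_split_of_right] deduces the properties of the left-hand map from those
    of the right-hand one.

    DTr M is taken from a minimal resolution, whose existence is [minimal_proj_resolution_exists]:
    an interval-finite quiver has no oriented cycles, so finitely generated representations have
    projective covers ([projective_cover]), and the kernel of a cover is again projective.

    For the second part, D is exact and fully faithful on locally finite-dimensional
    representations, exchanges proj and inj, preserves almost split sequences up to reversal
    ([drep_almost_split]), and satisfies D TrD M = DTr D M ([drep_TrD]). *)

Local Notation "g ** f" := (rcomp g f) (at level 40, left associativity).

(** * Finite-dimensional vector spaces *)

Section FiniteDimension.
Context (k : fieldType).
Implicit Types U V W : lmodType k.

Definition fdim V := exists n, inhabited (Vector.axiom n V).

Lemma fdim_iso V : fdim V -> exists n (f : {linear V -> 'rV[k]_n})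
  (g : {linear 'rV[k]_n -> V}), cancel f g /\ cancel g f.
Proof.
move=> [n [[f fl [g fK gK]]]]; exists n, (mklin fl).
have gl : linear g.
  by move=> c u v; apply: (can_inj fK); rewrite gK fl !gK.
by exists (mklin gl).
Qed.

Lemma iso_fdim V n (f : {linear V -> 'rV[k]_n}) (g : 'rV[k]_n -> V) :
  cancel f g -> cancel g f -> fdim V.
Proof.
by move=> fK gK; exists n; split; exists f; [exact: linearP|exists g].
Qed.

Lemma fdim_vect (vT : vectType k) : fdim vT.
Proof. by apply: (@iso_fdim vT _ v2r r2v); [exact: v2rK|exact: r2vK]. Qed.

Definition inv_fun (A B : Type) (f : A -> B)
  (H : forall b, exists a, f a = b) : B -> A := fun b => projT1 (cid (H b)).

Lemma inv_funK (A B : Type) (f : A -> B) H : cancel (@inv_fun A B f H) f.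
Proof. by move=> b; rewrite /inv_fun; case: cid. Qed.

Lemma inv_linear U V (f : {linear U -> V}) H : injective f ->
  linear (@inv_fun U V f H).
Proof. by move=> fi c u v; apply: fi; rewrite linearP !inv_funK. Qed.

Lemma linear_bij_inv U V (f : {linear U -> V}) : injective f ->
  (forall v, exists u, f u = v) ->
  exists g : {linear V -> U}, cancel f g /\ cancel g f.
Proof.
move=> fi fs; exists (mklin (inv_linear fs fi)); split=> u /=.
  by apply: fi; rewrite inv_funK.
exact: inv_funK.
Qed.

Lemma fdim_bij V (vT : vectType k) (f : {linear V -> vT}) : injective f ->
  (forall v, exists u, f u = v) -> fdim V.
Proof.
move=> fi fs; have [g [fK gK]] := linear_bij_inv fi fs.
apply: (@iso_fdim V _ (v2r \o f) (g \o r2v)) => v /=; first by rewrite v2rK.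
by rewrite gK r2vK.
Qed.

(** Among the subspaces contained in [S] take one of maximal dimension: adding the line of any
    vector of [S] stays inside [S], so it cannot enlarge the subspace. *)
Lemma subspace_vspace (vT : vectType k) (S : vT -> Prop) :
  S 0 -> (forall c u v, S u -> S v -> S (c *: u + v)) ->
  exists U : {vspace vT}, forall v, S v <-> v \in U.
Proof.
move=> S0 SP.
pose ok n := `[< exists U : {vspace vT},
  \dim U = n /\ forall v, v \in U -> S v >].
have ok0 : exists n, ok n.
  exists 0%N; apply/asboolP; exists 0%VS; split; first exact: dimv0.
  by move=> v; rewrite memv0 => /eqP->.
have okb n : ok n -> (n <= \dim {:vT})%N.
  by move=> /asboolP[U [<- _]]; exact: dimvS (subvf U).
case: (ex_maxnP ok0 okb) => n /asboolP[U [Un US]] maxn.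
exists U => v; split=> [Sv|]; last exact: US.
have: ok (\dim (U + <[v]>)%VS).
  apply/asboolP; exists (U + <[v]>)%VS; split=> // w.
  case/memv_addP => u uU [x /vlineP[c ->] ->]; rewrite addrC.
  by apply: SP => //; exact: US.
move/maxn => le.
have /eqP-> : U == (U + <[v]>)%VS by rewrite eqEdim addvSl Un.
by rewrite (subvP (addvSr U <[v]>%VS)) ?memv_line.
Qed.


Lemma fdim_inj U V (f : {linear U -> V}) : injective f -> fdim V -> fdim U.
Proof.
move=> fi /fdim_iso[n [e [e' [eK e'K]]]].
pose f' : {linear U -> 'rV[k]_n} := e \o f.
have f'i : injective f' by move=> u v /(can_inj eK)/fi.
have [|c u v [u' <-] [v' <-]|W WP] :=
  @subspace_vspace 'rV[k]_n (fun v => exists u, f' u = v).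
- by exists 0; rewrite linear0.
- by exists (c *: u' + v'); rewrite linearP.
apply: (@fdim_bij U (subvs_of W) (vsproj W \o f')) => [u v|w] /=.
  move/(congr1 vsval); rewrite !vsprojK => [/f'i//||]; apply/WP.
    by exists v.
  by exists u.
have [u uE] := (WP (vsval w)).2 (subvsP w).
by exists u; rewrite /= in uE *; rewrite uE vsvalK.
Qed.

(** A complement of the kernel is mapped bijectively onto [V]. *)
Lemma fdim_surj U V (f : {linear U -> V}) :
  (forall v, exists u, f u = v) -> fdim U -> fdim V.
Proof.
move=> fs /fdim_iso[n [e [e' [eK e'K]]]].
pose f' : {linear 'rV[k]_n -> V} := f \o e'.
have [|c u v /= u0 v0|K KP] := @subspace_vspace 'rV[k]_n (fun v => f' v = 0).
- exact: linear0.
- by rewrite !linearP u0 v0 scaler0 addr0.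
pose h : {linear subvs_of (K^C)%VS -> V} := f' \o vsval.
have hi : injective h.
  move=> u v huv; apply/eqP; rewrite -subr_eq0; apply/eqP/val_inj => /=.
  apply/eqP; rewrite -memv0 -(capv_compl K) memv_cap; apply/andP; split.
    by apply/KP; have /eqP := huv; rewrite -subr_eq0 -linearB => /eqP.
  exact: subvsP (u - v).
have hs v : exists u, h u = v.
  have [u <-] := fs v; set w := e u.
  have : w \in (K + K^C)%VS by rewrite addv_complf memvf.
  case/memv_addP => a /KP a0 [b bK wE]; exists (vsproj _ b).
  rewrite /= vsprojK // -[u]eK -/w wE linearD linearD /=.
  by rewrite -[f (e' a)]/(f' a) a0 add0r.
have [g [gK hK]] := linear_bij_inv hi hs.
exact: (fdim_bij (can_inj hK)) (fun u => ex_intro _ (h u) (gK u)).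
Qed.

Lemma fdim_prod U V : fdim U -> fdim V -> fdim (U * V)%type.
Proof.
move=> /fdim_iso[n [e [e' [eK _]]]] /fdim_iso[m [d [d' [dK _]]]].
have H : linear (fun p : U * V => row_mx (e p.1) (d p.2)).
  by move=> c p q; rewrite scale_row_mx add_row_mx !linearP.
apply: (fdim_inj (f := mklin H)); last exact: fdim_vect.
by case=> a b [c d''] /= /eq_row_mx[/(can_inj eK)-> /(can_inj dK)->].
Qed.

Lemma sum_row_linear V n (v : 'I_n -> V) :
  linear (fun w : 'rV[k]_n => \sum_i w 0 i *: v i).
Proof.
move=> c u w; rewrite scaler_sumr -big_split; apply: eq_bigr => i _.
by rewrite !mxE scalerDl scalerA.
Qed.

Lemma fdim_section U V (f : {linear U -> V}) : fdim V ->
  (forall v, exists u, f u = v) -> exists s : {linear V -> U}, cancel s f.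
Proof.
move=> /fdim_iso[n [e [e' [eK e'K]]]] fs.
pose u i := inv_fun fs (e' (delta_mx 0 i)).
exists (mklin (sum_row_linear u) \o e) => v /=.
rewrite linear_sum -[RHS]eK [e v in RHS]row_sum_delta linear_sum.
by apply: eq_bigr => i _; rewrite !linearZ /= /u inv_funK.
Qed.

Lemma fdim_basis V : fdim V -> exists n (b : 'I_n -> V) (b' : 'I_n -> kdual V),
  forall v, v = \sum_i (b' i v : k) *: b i.
Proof.
move=> /fdim_iso[n [e [e' [eK e'K]]]].
have H i : linear (fun v : V => e v 0 i : k^o).
  by move=> c u v; rewrite linearP !mxE.
exists n, (fun i => e' (delta_mx 0 i)), (fun i => mklin (H i)) => v.
rewrite -{1}[v]eK [e v in LHS]row_sum_delta linear_sum.
by apply: eq_bigr => i _; rewrite linearZ.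
Qed.

Lemma fdim_kdual V : fdim V -> fdim (kdual V).
Proof.
move=> /fdim_basis[n [b [b' bE]]].
have H : linear (fun t : kdual V => \row_i (t (b i) : k)).
  by move=> c u v; apply/rowP => i; rewrite !mxE.
apply: (fdim_inj (f := mklin H)); last exact: fdim_vect.
move=> s t /rowP st; apply: linear_ext => v; rewrite (bE v) !linear_sum.
by apply: eq_bigr => i _; rewrite !linearZ; have := st i; rewrite !mxE => ->.
Qed.

(** Reflexivity: the values of [F] on the coordinate functionals [b' i] are the coordinates of the
    representing vector. *)
Lemma double_dual V (F : kdual (kdual V)) : fdim V ->
  exists v, forall t : kdual V, F t = t v.
Proof.
move=> /fdim_basis[n [b [b' bE]]].
exists (\sum_i (F (b' i) : k) *: b i) => t.
have tE : t = \sum_i (t (b i) : k) *: b' i.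
  apply: linear_ext => v; rewrite {1}(bE v) linear_sum.
  have -> : (\sum_i (t (b i) : k) *: b' i) v = \sum_i (t (b i) : k) * b' i v.
    by elim/big_rec2: _ => //= i x y _ <-.
  by apply: eq_bigr => i _; rewrite linearZ; exact: mulrC.
rewrite {1}tE !linear_sum; apply: eq_bigr => i _.
by rewrite !linearZ; exact: mulrC.
Qed.

Lemma fdim_retraction U V (f : {linear U -> V}) : fdim V -> injective f ->
  exists r : {linear V -> U}, cancel f r.
Proof.
move=> fV fi; have fU := fdim_inj fi fV.
have [n [e [e' [eK e'K]]]] := fdim_iso fU.
have [m [d [d' [dK d'K]]]] := fdim_iso fV.
pose h : {linear 'rV[k]_n -> 'rV[k]_m} := d \o f \o e'.
have h0 : lker (linfun h) == 0%VS.
  apply/lker0P => u v; rewrite !lfunE /= => /(can_inj dK)/fi.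
  exact: (can_inj e'K).
exists (e' \o ((linfun h)^-1)%VF \o d) => u /=.
have -> : d (f u) = linfun h (e u) by rewrite lfunE /= eK.
by rewrite lker0_lfunK // eK.
Qed.

(** The projection [p] along [S] kills [S] but not [v], so some coordinate of [p] is the required
    functional. *)
Lemma separation V (S : V -> Prop) v : fdim V ->
  S 0 -> (forall c u v, S u -> S v -> S (c *: u + v)) -> ~ S v ->
  exists t : kdual V, t v != 0 /\ forall u, S u -> t u = 0.
Proof.
move=> /fdim_iso[n [e [e' [eK e'K]]]] S0 SP Sv.
have [|c u w Su Sw|U UP] := @subspace_vspace 'rV[k]_n (fun w => S (e' w)).
- by rewrite linear0.
- by rewrite linearP; exact: SP.
pose p (u : 'rV[k]_n) := u - projv U u.
have pl : linear p.
  by move=> c u w; rewrite /p linearP scalerBr opprD addrACA.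
have pv0 : p (e v) <> 0.
  move/subr0_eq => E; apply: Sv; rewrite -[v]eK; apply/UP.
  by rewrite E memv_proj.
have /existsNP[i /eqP pi] : ~ forall i, p (e v) 0 i = (0 : 'rV_n) 0 i.
  by move=> E; apply: pv0; apply/rowP.
have tl : linear (fun u => p (e u) 0 i : k^o).
  by move=> c u w; rewrite linearP pl !mxE.
exists (mklin tl); split; first by move: pi; rewrite [X in _ != X]mxE.
move=> u Su /=; rewrite /p projv_id ?subrr ?mxE //.
by apply/UP; rewrite eK.
Qed.

Lemma kdual_separates V v : fdim V -> v <> 0 -> exists t : kdual V, t v != 0.
Proof.
move=> fV v0; have [|||t [tv _]] := @separation V (fun u => u = 0) v fV => //.
  by move=> c u w -> ->; rewrite scaler0 addr0.
by exists t.
Qed.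

Lemma fdim_inj_surj V (f : {linear V -> V}) : fdim V -> injective f ->
  forall v, exists u, f u = v.
Proof.
move=> fV fi; have [n [e [e' [eK e'K]]]] := fdim_iso fV.
pose h : {linear 'rV[k]_n -> 'rV[k]_n} := e \o f \o e'.
have h0 : lker (linfun h) == 0%VS.
  apply/lker0P => u v; rewrite !lfunE /= => /(can_inj eK)/fi.
  exact: (can_inj e'K).
move=> v; exists (e' (((linfun h)^-1)%VF (e v))).
apply: (can_inj eK); rewrite -[LHS]/(h _).
have := lker0_lfunVK h0 (e v); rewrite lfunE; exact.
Qed.

Lemma fdim_surj_inj V (f : {linear V -> V}) : fdim V ->
  (forall v, exists u, f u = v) -> injective f.
Proof.
move=> fV fs; have [s sK] := fdim_section fV fs.
have ss := fdim_inj_surj fV (can_inj sK).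
by move=> u v; have [u' <-] := ss u; have [v' <-] := ss v; rewrite !sK => ->.
Qed.

Fixpoint lin_iter V (f : {linear V -> V}) n : {linear V -> V} :=
  if n is m.+1 then f \o lin_iter f m else idfun.

Lemma lin_iterD V (f : {linear V -> V}) m n v :
  lin_iter f (m + n) v = lin_iter f m (lin_iter f n v).
Proof. by elim: m => //= m ->. Qed.

(** The images of the powers of [f] decrease. If that of the power m+1 has least dimension, the
    power 2(m+1) has the same image, so [v] and a value of the power m+1 agree after applying that
    power. The exponent is kept positive so that [f] itself is a factor of the power. *)
Lemma fitting V (f : {linear V -> V}) v : fdim V ->
  exists n w, lin_iter f n.+1 (v - lin_iter f n.+1 w) = 0.
Proof.
move=> fV; have [n [e [e' [eK e'K]]]] := fdim_iso fV.
have im m : exists U : {vspace 'rV[k]_n},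
    forall w, (exists u, e (lin_iter f m.+1 u) = w) <-> w \in U.
  apply: subspace_vspace; first by exists 0; rewrite !linear0.
  by move=> c _ _ [u <-] [w <-]; exists (c *: u + w); rewrite !linearP.
pose ok d := `[< exists m (U : {vspace 'rV[k]_n}), \dim U = d /\
   forall w, (exists u, e (lin_iter f m.+1 u) = w) <-> w \in U >].
have [|d /asboolP[m [U [Ud UP]]] mind] := @ex_minnP ok.
  by have [U UP] := im 0%N; exists (\dim U); apply/asboolP; exists 0%N, U.
have [U' U'P] := im (m + m.+1)%N.
have UU' : (U' == U)%VS.
  rewrite eqEdim Ud mind ?andbT; last by apply/asboolP; exists (m + m.+1)%N, U'.
  apply/subvP => w /U'P[u <-]; apply/UP.
  by exists (lin_iter f m.+1 u); rewrite -addSn lin_iterD.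
exists m.
have /U'P[w /(can_inj eK)] : e (lin_iter f m.+1 v) \in U'.
  by rewrite (eqP UU'); apply/UP; exists v.
by rewrite -addSn lin_iterD => E; exists w; rewrite linearB E subrr.
Qed.

(** Apply [f] after a linear pseudo-inverse of [L]: sending [u] through [L] and back changes it only
    by an element of the kernel of [L], which [f] kills. *)
Lemma factor_linear U V W (L : {linear U -> V}) (f : {linear U -> W}) :
  fdim U -> fdim V -> (forall u, L u = 0 -> f u = 0) ->
  exists h : {linear V -> W}, forall u, h (L u) = f u.
Proof.
move=> /fdim_iso[n [e [e' [eK e'K]]]] /fdim_iso[m [d [d' [dK d'K]]]] Lf.
pose L' : {linear 'rV[k]_n -> 'rV[k]_m} := d \o L \o e'.
exists (f \o e' \o ((linfun L')^-1)%VF \o d) => u /=.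
set w := (_^-1)%VF _; apply/eqP; rewrite -subr_eq0 -linearB Lf //.
apply: (can_inj dK); rewrite linearB linearB !linear0.
have -> : d (L (e' w)) = linfun L' w by rewrite lfunE.
by rewrite limg_lfunVK ?subrr // -{1}[u]eK -[d _]/(L' _) -lfunE memv_img ?memvf.
Qed.

Lemma fdim_freeg (K : choiceType) : finite_set [set: K] ->
  fdim {freeg K / k}.
Proof.
move=> /finite_seqP[s sE].
have H : linear (fun D : {freeg K / k} =>
    \row_(i < size s) coeff (tnth (in_tuple s) i) D).
  by move=> c u v; apply/rowP => i; rewrite !mxE coeffD coeffZ.
apply: (fdim_inj (f := mklin H)); last exact: fdim_vect.
move=> D E /rowP DE; apply/eqP/freeg_eqP => x.
have xs : x \in s.
  by have : setT x by []; rewrite sE.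
have := DE (Ordinal (etrans (index_mem x s) xs)).
by rewrite !mxE (tnth_nth x) /= nth_index.
Qed.

End FiniteDimension.

(** * Subspaces of arbitrary modules, as modules *)

Record submodule (k : fieldType) (V : lmodType k) := Submodule {
  in_submodule :> V -> Prop;
  submodule0 : in_submodule 0;
  submoduleP : forall c u v,
    in_submodule u -> in_submodule v -> in_submodule (c *: u + v)
}.

(** The subtype structures are built from boolean predicates, hence the passage through classical
    reflection. *)
Definition submodule_pred (k : fieldType) (V : lmodType k) (S : submodule V) :
  {pred V} := fun v => `[< S v >].

Lemma submodule_closed (k : fieldType) (V : lmodType k) (S : submodule V) :
  submod_closed (submodule_pred S).
Proof.
split=> [|c u v]; first by apply/asboolP; exact: submodule0.
by move=> /asboolP Su /asboolP Sv; apply/asboolP; exact: submoduleP.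
Qed.

HB.instance Definition _ (k : fieldType) (V : lmodType k) (S : submodule V) :=
  GRing.isSubmodClosed.Build k V (submodule_pred S) (submodule_closed S).

Record subspace (k : fieldType) (V : lmodType k) (S : submodule V) := Subspace {
  subspace_val :> V;
  subspace_valP : subspace_val \in submodule_pred S
}.

Section SubspaceModule.
Variables (k : fieldType) (V : lmodType k) (S : submodule V).

HB.instance Definition _ := [isSub for @subspace_val k V S].
HB.instance Definition _ := [Choice of subspace S by <:].
HB.instance Definition _ := [SubChoice_isSubLmodule of subspace S by <:].

Definition subspace_incl : {linear subspace S -> V} := val.

Lemma subspace_inclP (u : subspace S) : S (subspace_incl u).
Proof. by apply/asboolP; exact: (valP u). Qed.

Lemma subspace_incl_inj : injective subspace_incl.
Proof. exact: val_inj. Qed.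

Definition to_subspace (v : V) (Sv : S v) : subspace S :=
  Subspace (asboolT Sv : v \in submodule_pred S).

Lemma corestrict_linear (U : lmodType k) (f : {linear U -> V})
  (H : forall u, S (f u)) : linear (fun u => to_subspace (H u)).
Proof. by move=> c u v; apply: val_inj; rewrite /= linearP. Qed.

Definition corestrict (U : lmodType k) (f : {linear U -> V})
  (H : forall u, S (f u)) : {linear U -> subspace S} :=
  mklin (corestrict_linear H).

End SubspaceModule.

(** * Kernels, images and Fitting's lemma for representations *)

Section SubRepresentation.
Context (k : fieldType) (Q : quiver).

Section Def.
Variables (M : repn k Q) (S : forall x, submodule (M x)).
Hypothesis SA : forall x y (a : arrow x y) v, S x v -> S y (act M a v).

Definition subrep : repn k Q :=
  @Repn k Q (fun x => subspace (S x)) (fun x y a =>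
    corestrict (fun u => SA a (subspace_inclP u)
      : S y ((act M a \o subspace_incl (S x)) u))).

Program Definition subrep_incl : rhom subrep M :=
  RHom (rhom_at := fun x => subspace_incl (S x)) _.
Next Obligation. by []. Qed.

Lemma subrep_incl_mono : is_mono subrep_incl.
Proof. by move=> x; exact: subspace_incl_inj. Qed.

Lemma subrep_inclP x (v : M x) :
  S x v <-> exists u, subrep_incl x u = v.
Proof.
split=> [Sv|[u <-]]; last exact: subspace_inclP.
by exists (to_subspace Sv).
Qed.

End Def.


Implicit Types M N L X Y Z : repn k Q.

Lemma rhomE M N (f g : rhom M N) x v : f = g -> f x v = g x v.
Proof. by move->. Qed.

Lemma rcompA M N L X (h : rhom L X) (g : rhom N L) (f : rhom M N) :
  h ** (g ** f) = h ** g ** f.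
Proof. exact: rhom_ext. Qed.

Lemma rcomp1 M N (f : rhom M N) : f ** rid M = f.
Proof. exact: rhom_ext. Qed.

Lemma rcomp1l M N (f : rhom M N) : rid N ** f = f.
Proof. exact: rhom_ext. Qed.

Lemma postcomp_linear X M N (g : rhom M N) :
  linear (fun h : rhom X M => g ** h).
Proof. by move=> c h h'; apply: rhom_ext => x v; exact: linearP. Qed.

Definition postcomp X M N (g : rhom M N) : {linear rhom X M -> rhom X N} :=
  mklin (@postcomp_linear X M N g).

Definition precomp M N X (f : rhom M N) : {linear rhom N X -> rhom M X} :=
  mklin (@precomp_linear k Q M N X f).

(** Preimages under an injective map are unique, so choosing them vertexwise is automatically linear
    and compatible with the arrows. *)
Lemma lift_mono X Y Z (i : rhom X Y) (h : rhom Z Y) : is_mono i ->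
  (forall x v, exists u, i x u = h x v) -> exists h', i ** h' = h.
Proof.
move=> im H; pose h0 x v := projT1 (cid (H x v)).
have h0E x v : i x (h0 x v) = h x v by rewrite /h0; case: cid.
have h0l x : linear (h0 x).
  by move=> c u v; apply: im; rewrite linearP !h0E linearP.
have h0a x y (a : arrow x y) v : mklin (h0l y) (act Z a v) =
    act X a (mklin (h0l x) v).
  by apply: im; rewrite /= rhom_act !h0E rhom_act.
by exists (RHom h0a); apply: rhom_ext => x v; exact: h0E.
Qed.

Lemma lift_epi Y W Z (q : rhom Y W) (h : rhom Y Z) : is_epi q ->
  (forall x v, q x v = 0 -> h x v = 0) -> exists h', h' ** q = h.
Proof.
move=> qe H.
pose h0 x w := h x (projT1 (cid (qe x w))).
have h0E x v : h0 x (q x v) = h x v.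
  rewrite /h0; case: cid => v' /= E; apply/eqP.
  by rewrite -subr_eq0 -linearB H // linearB E subrr.
have h0l x : linear (h0 x).
  move=> c u v; have [u' <-] := qe x u; have [v' <-] := qe x v.
  by rewrite -linearP !h0E linearP.
have h0a x y (a : arrow x y) v : mklin (h0l y) (act W a v) =
    act Z a (mklin (h0l x) v).
  by have [w <-] := qe x v; rewrite /= -rhom_act !h0E rhom_act.
by exists (RHom h0a); apply: rhom_ext => x v; exact: h0E.
Qed.

Lemma bijective_is_iso M N (f : rhom M N) : is_mono f -> is_epi f -> is_iso f.
Proof.
move=> fm fe; have [g fg] := lift_mono (h := rid N) fm (fun x v => fe x v).
exists g; split=> //; apply: rhom_ext => x v; apply: fm.
exact: (rhomE _ fg).
Qed.

Lemma is_iso_mono M N (f : rhom M N) : is_iso f -> is_mono f.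
Proof. by case=> g [gf _] x; apply: can_inj => v; exact: (rhomE _ gf). Qed.

Lemma is_iso_epi M N (f : rhom M N) : is_iso f -> is_epi f.
Proof. by case=> g [_ fg] x v; exists (g x v); exact: (rhomE _ fg). Qed.

Lemma retraction_epi M N (f : rhom M N) : retraction f -> is_epi f.
Proof. by case=> s fs x v; exists (s x v); exact: (rhomE _ fs). Qed.

Lemma is_iso_comp M N L (g : rhom N L) (f : rhom M N) :
  is_iso g -> is_iso f -> is_iso (g ** f).
Proof.
move=> gi fi; apply: bijective_is_iso => x.
  by apply: inj_comp; exact: is_iso_mono.
move=> w; have [v <-] := is_iso_epi gi w; have [u <-] := is_iso_epi fi v.
by exists u.
Qed.

Lemma isomorphic_refl M : isomorphic M M.
Proof. by exists (rid M), (rid M); split; exact: rcomp1. Qed.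

Lemma isomorphic_sym M N : isomorphic M N -> isomorphic N M.
Proof. by case=> f [g [? ?]]; exists g, f. Qed.

Lemma isomorphic_trans M N L :
  isomorphic M N -> isomorphic N L -> isomorphic M L.
Proof. by case=> f fi [g gi]; exists (g ** f); exact: is_iso_comp. Qed.

Lemma lfd_mono M N (f : rhom M N) : is_mono f -> lfd N -> lfd M.
Proof. by move=> fm fN x; exact: fdim_inj (fm x) (fN x). Qed.

Lemma lfd_epi M N (f : rhom M N) : is_epi f -> lfd M -> lfd N.
Proof. by move=> fe fM x; exact: fdim_surj (fe x) (fM x). Qed.

Lemma lfd_isomorphic M N : isomorphic M N -> lfd N -> lfd M.
Proof. by case=> f /is_iso_mono; exact: lfd_mono. Qed.

Lemma lfd_rsum M N : lfd M -> lfd N -> lfd (rsum M N).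
Proof. by move=> fM fN x; exact: fdim_prod. Qed.

Lemma lfd_rzero : lfd (rzero k Q).
Proof. by move=> x; exact: fdim_vect. Qed.

Lemma endo_mono_iso M (f : rhom M M) : lfd M -> is_mono f -> is_iso f.
Proof.
move=> fM fm; apply: bijective_is_iso => // x.
exact: fdim_inj_surj (fM x) (fm x).
Qed.

Lemma endo_epi_iso M (f : rhom M M) : lfd M -> is_epi f -> is_iso f.
Proof.
move=> fM fe; apply: bijective_is_iso => // x.
exact: fdim_surj_inj (fM x) (fe x).
Qed.

Lemma kernel_exists M N (f : rhom M N) : exists X (i : rhom X M), is_kernel i f.
Proof.
have S0 x : f x 0 = 0 by exact: linear0.
have SP x c u v : f x u = 0 -> f x v = 0 -> f x (c *: u + v) = 0.
  by move=> u0 v0; rewrite linearP u0 v0 scaler0 addr0.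
pose S x := Submodule (S0 x) (SP x).
have SA x y (a : arrow x y) v : S x v -> S y (act M a v).
  by rewrite /= rhom_act => ->; rewrite linear0.
exists (subrep SA), (subrep_incl SA); split; first exact: subrep_incl_mono.
by move=> x w; exact: (subrep_inclP SA).
Qed.

Lemma image_exists M N (f : rhom M N) :
  exists R (e : rhom M R) (i : rhom R N), [/\ is_epi e, is_mono i & i ** e = f].
Proof.
have S0 x : exists u, f x u = 0 by exists 0; exact: linear0.
have SP x c u v : (exists u', f x u' = u) -> (exists v', f x v' = v) ->
  exists w, f x w = c *: u + v.
  by move=> [u' <-] [v' <-]; exists (c *: u' + v'); rewrite linearP.
pose S x := Submodule (S0 x) (SP x).
have SA x y (a : arrow x y) v : S x v -> S y (act N a v).
  by move=> [u <-]; exists (act M a u); rewrite rhom_act.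
have im := subrep_incl_mono (SA := SA).
have [|e eE] := lift_mono (h := f) im.
  by move=> x v; apply/(subrep_inclP SA); exists v.
exists (subrep SA), e, (subrep_incl SA); split=> //.
move=> x w.
have /(subrep_inclP SA)[v vE] : exists u, subrep_incl SA x u = subrep_incl SA x w.
  by exists w.
by exists v; apply: im; rewrite -vE; exact: (rhomE _ eE).
Qed.

Program Definition rinl M N : rhom M (rsum M N) :=
  @RHom k Q M (rsum M N) (fun x => mklin (f := fun v : M x => (v, 0 : N x)) _) _.
Next Obligation.
by move=> M N x c u v; congr (_, _); rewrite /= scaler0 addr0.
Qed.
Next Obligation. by move=> M N x y a v; congr (_, _); rewrite /= linear0. Qed.

Program Definition rinr M N : rhom N (rsum M N) :=
  @RHom k Q N (rsum M N) (fun x => mklin (f := fun v : N x => (0 : M x, v)) _) _.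
Next Obligation.
by move=> M N x c u v; congr (_, _); rewrite /= scaler0 addr0.
Qed.
Next Obligation. by move=> M N x y a v; congr (_, _); rewrite /= linear0. Qed.

Program Definition rfst M N : rhom (rsum M N) M :=
  @RHom k Q (rsum M N) M (fun x => mklin (f := fun v : M x * N x => v.1) _) _.
Next Obligation. by []. Qed.
Next Obligation. by []. Qed.

Program Definition rsnd M N : rhom (rsum M N) N :=
  @RHom k Q (rsum M N) N (fun x => mklin (f := fun v : M x * N x => v.2) _) _.
Next Obligation. by []. Qed.
Next Obligation. by []. Qed.

Lemma rsum_biprod M N :
  rinl M N ** rfst M N + rinr M N ** rsnd M N = rid (rsum M N).
Proof.
by apply: rhom_ext => x [u v]; congr (_, _); rewrite /= ?addr0 ?add0r.
Qed.

(** The relations [p1 i2 = 0] and [p2 i1 = 0] are consequences: apply [p1] to the decomposition of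
    [i2 v], and [p2] to that of [i1 v]. *)
Lemma biprod_isomorphic M A B (i1 : rhom A M) (i2 : rhom B M)
    (p1 : rhom M A) (p2 : rhom M B) :
  p1 ** i1 = rid A -> p2 ** i2 = rid B -> i1 ** p1 + i2 ** p2 = rid M ->
  isomorphic M (rsum A B).
Proof.
move=> E1 E2 E.
pose f : rhom M (rsum A B) := rinl A B ** p1 + rinr A B ** p2.
have fE x v : f x v = (p1 x v, p2 x v).
  by congr (_, _); rewrite /= ?addr0 ?add0r.
have ei x v : i1 x (p1 x v) + i2 x (p2 x v) = v by exact: (rhomE _ E).
have e1 x v : p1 x (i1 x v) = v by exact: (rhomE _ E1).
have e2 x v : p2 x (i2 x v) = v by exact: (rhomE _ E2).
have e12 x v : p1 x (i2 x v) = 0.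
  have := congr1 (p1 x) (ei x (i2 x v)); rewrite linearD e1 e2.
  by rewrite -[X in _ = X]addr0 => /addrI.
have e21 x v : p2 x (i1 x v) = 0.
  have := congr1 (p2 x) (ei x (i1 x v)); rewrite linearD e1 e2.
  by rewrite -[X in _ = X]add0r => /addIr.
exists f; apply: bijective_is_iso => x.
  move=> u v; rewrite !fE => -[u1 u2].
  by rewrite -(ei x u) -(ei x v) u1 u2.
move=> [u v]; exists (i1 x u + i2 x v); rewrite fE !linearD.
by rewrite e1 e2 e12 e21 addr0 add0r.
Qed.

Lemma split_epi_kernel M R (g : rhom M R) (s : rhom R M) : g ** s = rid R ->
  exists K (i : rhom K M), is_kernel i g /\ isomorphic M (rsum K R).
Proof.
move=> gs; have gsE x v : g x (s x v) = v by exact: (rhomE _ gs).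
have [K [i [im ie]]] := kernel_exists g; exists K, i; split=> //.
have [|r rE] := @lift_mono _ _ _ i (rid M - s ** g) im.
  by move=> x v; apply/ie; rewrite linearB /= gsE subrr.
have irE x v : i x (r x v) = v - s x (g x v) by exact: (rhomE _ rE).
apply: (biprod_isomorphic (i1 := i) (i2 := s) (p1 := r)) gs _.
  apply: rhom_ext => x v; apply: im; rewrite /= irE.
  have -> : g x (i x v) = 0 by apply/ie; exists v.
  by rewrite linear0 subr0.
by apply: rhom_ext => x v; rewrite /= irE subrK.
Qed.

(** A retraction splits [M] as its kernel plus [R], and one of the two summands vanishes. *)
Lemma indecomposable_retraction M R (g : rhom M R) : lfd M -> indecomposable M ->
  retraction g -> is_iso g \/ is_zero R.
Proof.
move=> fM [_ iM] gr; have ge := retraction_epi gr; case: gr => s gs.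
have [K [i [[im ie] MKR]]] := split_epi_kernel gs.
have [K0|] := iM K R (lfd_mono im fM) (lfd_epi ge fM) MKR; last by right.
left; apply: bijective_is_iso => // x u v uv; apply/eqP.
rewrite -subr_eq0; apply/eqP.
have /ie[w <-] : g x (u - v) = 0 by rewrite linearB uv subrr.
by rewrite (K0 x w) linear0.
Qed.

Fixpoint riter M (f : rhom M M) n : rhom M M :=
  if n is m.+1 then f ** riter f m else rid M.

Lemma riter_postcomp M (f h : rhom M M) n :
  lin_iter (postcomp M f) n h = riter f n ** h.
Proof. by elim: n => [|n IH] /=; rewrite ?rcomp1l // IH rcompA. Qed.

Lemma riterS M (f : rhom M M) n : riter f n.+1 = riter f n ** f.
Proof. by elim: n => [|n IH]; rewrite /= ?rcomp1 ?rcomp1l // -rcompA -IH. Qed.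

(* Fitting's lemma is applied to composition with f on the finite-dimensional   *)
(* space End(M): at a single vertex the exponent n would depend on the vertex.  *)
Lemma endo_iso_or_nilpotent M (f : rhom M M) :
  lfd M -> indecomposable M -> fdim (rhom M M) ->
  is_iso f \/ exists n, riter f n = 0.
Proof.
move=> fM iM fE; have [n [w]] := fitting (postcomp M f) (rid M) fE.
rewrite !riter_postcomp; set h := riter f n.+1 => hw.
have hwE x v : h x v = h x (h x (w x v)).
  have : h x (v - h x (w x v)) = 0 := rhomE v hw.
  by rewrite linearB => /subr0_eq.
have [R [e [i [ee im ieE]]]] := image_exists h.
have hE x v : h x v = i x (e x v) by rewrite -ieE.
(* Since h = h h w, the composite [e i] is onto the image [R] of [h], hence invertible; so [e] is a
   retraction and [R] a direct summand of [M]. *)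
have [||t [_ tE]] := @endo_epi_iso R (e ** i).
- exact: lfd_epi ee fM.
- move=> x r; have [v <-] := ee x r; exists (e x (w x v)).
  by apply: im; rewrite /= -!hE -hwE.
have er : retraction e by exists (i ** t); rewrite rcompA.
have [ei|R0] := indecomposable_retraction fM iM er; last first.
  right; exists n.+1; apply: rhom_ext => x v.
  by rewrite -[LHS]/(h x v) hE (R0 x (e x v)) linear0.
left; apply: endo_mono_iso => // x u v uv; apply: (is_iso_mono ei).
apply: im; rewrite -!hE /h riterS /=; congr (riter f n x _).
exact: uv.
Qed.

End SubRepresentation.

(** * The projectives P_a and the Nakayama functor *)

Section Yoneda.
Context (k : fieldType) (Q : quiver).
Implicit Types M N L X Y Z P : repn k Q.

Fixpoint path_act M (x y : Q) (r : qpath x y) : {linear M x -> M y} :=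
  match r in qpath _ y return {linear M x -> M y} with
  | qpath_triv => idfun
  | qpath_post _ _ s a => act M a \o path_act M s
  end.

Program Definition yoneda M (x : Q) (z : M x) : rhom (proj_rep k x) M :=
  @RHom k Q (proj_rep k x) M
    (fun y => linear_extension (fun r : qpath x y => path_act M r z)) _.
Next Obligation.
move=> M x z y w a v.
pose F t := linear_extension (fun r : qpath x t => path_act M r z).
pose post := act (proj_rep k x) a.
change ((F w \o post) v = (act M a \o F y) v); apply: freeg_linear_ext => r.
by rewrite /F /post /= !liftU !scale1r liftU scale1r.
Qed.

Definition triv (x : Q) : proj_rep k x x := << qpath_triv x >>.

Lemma yoneda_triv M x (z : M x) : yoneda z x (triv x) = z.
Proof. exact: linear_extensionU. Qed.

Lemma yoneda_ext M x (f g : rhom (proj_rep k x) M) :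
  f x (triv x) = g x (triv x) -> f = g.
Proof.
move=> fg; apply: rhom_ext => y; apply: freeg_linear_ext.
elim=> // y' z r IH a.
have -> : << qpath_post r a >> = act (proj_rep k x) a << r >>.
  by rewrite /= liftU scale1r.
by rewrite !rhom_act IH.
Qed.

Lemma yonedaE M x (f : rhom (proj_rep k x) M) : yoneda (f x (triv x)) = f.
Proof. by apply: yoneda_ext; rewrite yoneda_triv. Qed.

Lemma yoneda_comp M N x (z : M x) (g : rhom M N) :
  g ** yoneda z = yoneda (g x z).
Proof. by apply: yoneda_ext; rewrite yoneda_triv /= liftU scale1r. Qed.

Lemma yoneda_id x : yoneda (triv x) = rid (proj_rep k x).
Proof. exact: (yonedaE (rid _)). Qed.

Lemma yoneda_linear M x : linear (@yoneda M x).
Proof.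
by move=> c u v; apply: yoneda_ext; rewrite yoneda_triv /= !liftU !scale1r.
Qed.

Lemma yoneda_act M x y (b : arrow x y) (z : M x) :
  yoneda (act M b z) = yoneda z ** right_mult k b.
Proof.
apply: yoneda_ext; rewrite yoneda_triv.
by rewrite /= !(liftU, scale1r).
Qed.

(* A finite family of elements of P together with dual coordinate maps; it    *)
(* need not be irredundant.                                                   *)
Record dual_basis P (T : finType) := DualBasis {
  db_vertex : T -> Q;
  db_elt : forall t, P (db_vertex t);
  db_coord : forall t, rhom P (proj_rep k (db_vertex t));
  db_sum : \sum_t yoneda (db_elt t) ** db_coord t = rid P
}.

Lemma rhom_sumE M N (I : finType) (F : I -> rhom M N) x v :
  (\sum_i F i) x v = \sum_i F i x v.
Proof. by elim/big_rec2: _ => //= i y1 y2 _ <-. Qed.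

Lemma db_sumE P T (b : dual_basis P T) x (v : P x) :
  \sum_t yoneda (db_elt b t) x (db_coord b t x v) = v.
Proof. by have := rhomE v (db_sum b); rewrite rhom_sumE. Qed.

(** A morphism out of [P] is determined by its finitely many values at the basis elements; lifting
    and the description of functionals on Hom(P, Z) both start from this. *)
Lemma db_expand P T (b : dual_basis P T) Z (f : rhom P Z) :
  f = \sum_t yoneda (f _ (db_elt b t)) ** db_coord b t.
Proof.
apply: rhom_ext => x v; rewrite -{1}(db_sumE b v) linear_sum rhom_sumE.
by apply: eq_bigr => t _; rewrite -yoneda_comp.
Qed.

Lemma db_lift P T (b : dual_basis P T) X Y (p : rhom X Y) (f : rhom P Y) :
  is_epi p -> exists g, p ** g = f.
Proof.
move=> pe; pose x t := projT1 (cid (pe _ (f _ (db_elt b t)))).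
have xE t : p _ (x t) = f _ (db_elt b t) by rewrite /x; case: cid.
exists (\sum_t yoneda (x t) ** db_coord b t).
rewrite [RHS](db_expand b) -[LHS]/(postcomp P p _) linear_sum.
by apply: eq_bigr => t _; rewrite /= rcompA yoneda_comp xE.
Qed.

Definition psum (l : seq Q) : repn k Q :=
  foldr (fun a => rsum (proj_rep k a)) (rzero k Q) l.

Lemma dual_basis_rsum A B S T : dual_basis A S -> dual_basis B T ->
  inhabited (dual_basis (rsum A B) (S + T)%type).
Proof.
move=> a b; split.
pose vt (t : S + T) :=
  match t with inl s => db_vertex a s | inr t => db_vertex b t end.
pose et (t : S + T) : rsum A B (vt t) :=
  match t with inl s => rinl A B _ (db_elt a s)
  | inr t => rinr A B _ (db_elt b t) end.
pose ct (t : S + T) : rhom (rsum A B) (proj_rep k (vt t)) :=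
  match t with inl s => db_coord a s ** rfst A B
  | inr t => db_coord b t ** rsnd A B end.
apply: (@DualBasis _ _ vt et ct); rewrite big_sumType -[RHS]rsum_biprod.
congr (_ + _); apply: rhom_ext => x v; rewrite rhom_sumE.
  rewrite -[RHS]/(rinl A B x (rfst A B x v)).
  rewrite -[in RHS](db_sumE a (rfst A B x v)) linear_sum.
  by apply: eq_bigr => t _; rewrite -[et _]/(rinl A B _ (db_elt a t)) -yoneda_comp.
rewrite -[RHS]/(rinr A B x (rsnd A B x v)).
rewrite -[in RHS](db_sumE b (rsnd A B x v)) linear_sum.
by apply: eq_bigr => t _; rewrite -[et _]/(rinr A B _ (db_elt b t)) -yoneda_comp.
Qed.

Lemma dual_basis_proj_rep a : dual_basis (proj_rep k a) unit.
Proof.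
apply: (@DualBasis _ unit (fun=> a) (fun=> triv a) (fun=> rid _)).
by rewrite (bigD1 tt) //= big1 ?addr0; [rewrite yoneda_id rcomp1|case].
Qed.

(** The cardinality is recorded because [projective_cover] minimises the number of generators. *)
Lemma psum_dual_basis l :
  exists2 T : finType, inhabited (dual_basis (psum l) T) & #|T| = size l.
Proof.
elim: l => [|a l [T [b] bl]].
  exists void; last exact: card_void.
  split; apply: (@DualBasis _ _ (fun v : void => match v with end)
    (fun v => match v with end) (fun v => match v with end)).
  by apply: rhom_ext => x v; rewrite /= [v]thinmx0 [LHS]thinmx0.
exists (unit + T)%type; last by rewrite card_sum card_unit bl.
exact: dual_basis_rsum (dual_basis_proj_rep a) b.
Qed.

Lemma dual_basis_iso M N T (f : rhom M N) : is_iso f -> dual_basis N T ->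
  inhabited (dual_basis M T).
Proof.
case=> g [gf _] b; split.
apply: (@DualBasis M T (db_vertex b) (fun t => g _ (db_elt b t))
  (fun t => db_coord b t ** f)).
rewrite -gf; apply: rhom_ext => x v; rewrite rhom_sumE -[RHS]/(g x (f x v)).
rewrite -[in RHS](db_sumE b (f x v)) linear_sum.
by apply: eq_bigr => t _; rewrite -yoneda_comp.
Qed.

Lemma in_proj_dual_basis P : in_proj P ->
  exists T : finType, inhabited (dual_basis P T).
Proof.
case=> s [f fi]; have [T [b] _] := psum_dual_basis s; exists T.
exact: dual_basis_iso fi b.
Qed.

Lemma in_proj_lift P X Y (p : rhom X Y) (f : rhom P Y) : in_proj P ->
  is_epi p -> exists g, p ** g = f.
Proof. by case/in_proj_dual_basis=> T [b]; exact: (db_lift b). Qed.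

Lemma fdim_rhom_epi P M Z (p : rhom P M) : is_epi p ->
  fdim (rhom P Z) -> fdim (rhom M Z).
Proof.
move=> pe fP; apply: (fdim_inj (f := precomp Z p) _ fP) => f g fg.
by apply: rhom_ext => x v; have [u <-] := pe x v; exact: (rhomE u fg).
Qed.

(** By induction on the number of summands: by Yoneda, Hom(P_a + B, Z) embeds in Z(a) x Hom(B,
    Z). *)
Lemma fdim_rhom P Z : in_proj P -> lfd Z -> fdim (rhom P Z).
Proof.
case=> s PE fZ.
have [f fe] : exists f : rhom (psum s) P, is_epi f.
  by have [f /is_iso_epi fe] := isomorphic_sym PE; exists f.
apply: fdim_rhom_epi fe _ => {P f PE}.
elim: s => [|a s IH].
  apply: (fdim_inj (f := \0%R : rhom (psum [::]) Z -> 'rV[k]_0)); last first.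
    exact: fdim_vect.
  move=> f g _; apply: rhom_ext => x v.
  by rewrite [v]thinmx0 !linear0.
pose A := proj_rep k a; pose B := psum s.
have H : linear (fun f : rhom (psum (a :: s)) Z =>
    (f a (rinl A B a (triv a)), f ** rinr A B)).
  by move=> c f g; congr (_, _); exact: rhom_ext.
apply: (fdim_inj (f := mklin H)); last exact: fdim_prod.
move=> f g fg; apply: rhom_ext => x [u v].
have E1 : f ** rinl A B = g ** rinl A B.
  by apply: yoneda_ext; exact: (congr1 fst fg).
have E2 : f ** rinr A B = g ** rinr A B := congr1 snd fg.
have -> : (u, v) = rinl A B x u + rinr A B x v.
  by congr (_, _); rewrite /= ?addr0 ?add0r.
by rewrite !linearD; congr (_ + _); [exact: (rhomE u E1)|exact: (rhomE v E2)].
Qed.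

Lemma lfd_proj_rep (a : Q) : interval_finite Q -> lfd (proj_rep k a).
Proof. by move=> fQ x; exact: (@fdim_freeg k _ (fQ a x)). Qed.

Lemma lfd_in_proj P : interval_finite Q -> in_proj P -> lfd P.
Proof.
move=> fQ [s /lfd_isomorphic]; apply; elim: s => [|a s IH]; first exact: lfd_rzero.
by apply: lfd_rsum => //; exact: lfd_proj_rep.
Qed.

End Yoneda.

(** * The pairing D Hom(P, Z) = Hom(Z, nu P) *)

Section Nakayama.
Context (k : fieldType) (Q : quiver).
Implicit Types M N L X Y Z P : repn k Q.

Lemma nakayama_pairing_linear P Z (t : kdual (rhom P Z)) x :
  linear (fun z : Z x => kdual_map (postcomp P (yoneda z)) t
                         : kdual (rhom P (proj_rep k x))).
Proof.
move=> c u v; apply: linear_ext => f.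
rewrite /= yoneda_linear -linearZ -linearD; congr (t _).
exact: rhom_ext.
Qed.

(* Pulling functionals back along Hom(P, A) (x) Z -> Hom(P, Z).               *)
Program Definition nakayama_pairing P Z (t : kdual (rhom P Z)) :
    rhom Z (nakayama P) :=
  @RHom k Q Z (nakayama P) (fun x => mklin (@nakayama_pairing_linear P Z t x)) _.
Next Obligation.
move=> P Z t x y a z; apply: linear_ext => f /=.
by rewrite yoneda_act rcompA.
Qed.

Lemma nakayama_pairing_mapl P P' Z (f : rhom P P') (t : kdual (rhom P Z)) :
  nakayama_map f ** nakayama_pairing t =
  nakayama_pairing (kdual_map (precomp Z f) t).
Proof.
by apply: rhom_ext => x z; apply: linear_ext => h /=; rewrite rcompA.
Qed.

Lemma nakayama_pairing_mapr P Z Z' (g : rhom Z' Z) (t : kdual (rhom P Z)) :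
  nakayama_pairing t ** g = nakayama_pairing (kdual_map (postcomp P g) t).
Proof.
by apply: rhom_ext => x z; apply: linear_ext => h /=; rewrite -yoneda_comp rcompA.
Qed.

(** Precomposed with [z], read as P_x -> Z, the morphism [u] becomes a morphism P_x -> nu P. By
    Yoneda it is determined by its value at the trivial path, the functional u(z), and therefore
    equals the pairing with u(z); evaluate both at [c]. *)
Lemma nakayama_trace P Z (u : rhom Z (nakayama P)) x y (z : Z x)
    (c : proj_rep k x y) (h : rhom P (proj_rep k y)) :
  (u y (yoneda z y c) : kdual _) h = (u x z : kdual _) (yoneda c ** h).
Proof.
pose t : kdual (rhom P (proj_rep k x)) := u x z.
have E : u ** yoneda z = nakayama_pairing t.
  apply: yoneda_ext; apply: linear_ext => f.
  by rewrite -[LHS]/((u x (yoneda z x (triv k x)) : kdual _) f) yoneda_triv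
     /= yoneda_id rcomp1l.
have := rhomE c E => /(congr1 (fun F : kdual _ => F h)).
exact.
Qed.

(** The functional must satisfy t(zh) = u(z)(h). Expanding [f] as the sum of its values f(e_i)
    composed with the coordinates c_i forces t(f) to be the sum of the u(f(e_i))(c_i). *)
Lemma nakayama_pairing_surj P T (b : dual_basis P T) Z
    (u : rhom Z (nakayama P)) : exists t, nakayama_pairing t = u.
Proof.
have H : linear (fun f : rhom P Z => \sum_t
    ((u _ (f _ (db_elt b t)) : kdual _) (db_coord b t) : k^o)).
  move=> c f g; rewrite scaler_sumr -big_split; apply: eq_bigr => t _ /=.
  by rewrite linearP.
exists (mklin H); apply: rhom_ext => x z; apply: linear_ext => h.
rewrite -[LHS]/(\sum_t ((u _ (yoneda z _ (h _ (db_elt b t))) : kdual _)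
   (db_coord b t) : k^o)).
under eq_bigr => t _ do rewrite nakayama_trace.
rewrite -linear_sum; congr ((u x z : kdual _) _).
by rewrite [RHS](db_expand b).
Qed.

Lemma nakayama_pairing_inj P T (b : dual_basis P T) Z :
  injective (@nakayama_pairing P Z).
Proof.
move=> s t st; apply: linear_ext => f.
rewrite (db_expand b f) !linear_sum; apply: eq_bigr => i _.
exact: (congr1 (fun F : kdual _ => F (db_coord b i))
  (rhomE (f _ (db_elt b i)) st)).
Qed.

Lemma nakayama_pairing_linear2 P Z : linear (@nakayama_pairing P Z).
Proof. by move=> c s t; apply: rhom_ext => x z; exact: linear_ext. Qed.

(* [t] identifies w with an element of D D Hom(P, P'), that is, with some f. *)
Lemma nakayama_full P P' (w : rhom (nakayama P) (nakayama P')) :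
  in_proj P -> in_proj P' -> lfd P' -> exists f, nakayama_map f = w.
Proof.
move=> iP iP' fP'; have [T' [b']] := in_proj_dual_basis iP'.
have [t tw] := nakayama_pairing_surj b' w.
pose F : kdual (kdual (rhom P P')) :=
  t \o mklin (@nakayama_pairing_linear2 P P').
have [f fE] := double_dual F (fdim_rhom iP fP').
exists f; rewrite -tw; apply: rhom_ext => x z; apply: linear_ext => h.
pose s := kdual_map (postcomp P h) z; rewrite -[LHS]/(s f) -fE -[LHS]/(t _).
rewrite -[RHS]/(t (yoneda z ** h)); congr (t _); apply: rhom_ext => y c.
apply: linear_ext => g.
rewrite -[LHS]/((z : kdual _) (h ** (yoneda c ** g))) rcompA yoneda_comp.
by rewrite -(nakayama_trace (rid (nakayama P)) z).
Qed.

(** If nu f = 0, every functional on the finite-dimensional space Hom(P, P_a) kills c f for each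
    coordinate [c] of [P']; hence all coordinates of [f] vanish. *)
Lemma nakayama_faithful P P' (f : rhom P P') : in_proj P -> in_proj P' ->
  interval_finite Q -> nakayama_map f = 0 -> f = 0.
Proof.
move=> iP iP' fQ f0; have [T [b]] := in_proj_dual_basis iP'.
have cf0 t : db_coord b t ** f = 0.
  apply: contrapT => /(kdual_separates (fdim_rhom iP (lfd_proj_rep _ _ fQ))).
  case=> z /eqP; apply.
  exact: (congr1 (fun F : rhom (nakayama P) (nakayama P') =>
    (F (db_vertex b t) z : kdual _) (db_coord b t)) f0).
apply: rhom_ext => x v; rewrite -[LHS](db_sumE b).
rewrite big1 // => t _; rewrite -[db_coord b t x _]/((db_coord b t ** f) x v).
by rewrite cf0 linear0.
Qed.

(** Through the pairing, extending [u] along [i] means extending a functional along the injection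
    Hom(P, X) -> Hom(P, Y). *)
Lemma nakayama_injective P X Y (i : rhom X Y) (u : rhom X (nakayama P)) :
  in_proj P -> lfd Y -> is_mono i -> exists u', u' ** i = u.
Proof.
move=> iP fY im; have [T [b]] := in_proj_dual_basis iP.
have [t <-] := nakayama_pairing_surj b u.
have [|r rK] := fdim_retraction (f := postcomp P i) (fdim_rhom iP fY).
  by move=> f g fg; apply: rhom_ext => x v; apply: im; exact: (rhomE v fg).
exists (nakayama_pairing (kdual_map r t)); rewrite nakayama_pairing_mapr.
congr nakayama_pairing; apply: linear_ext => f.
by rewrite /= -[i ** f]/(postcomp P i f) rK.
Qed.

Lemma lfd_nakayama P : interval_finite Q -> in_proj P -> lfd (nakayama P).
Proof.
move=> fQ iP x; apply: fdim_kdual; apply: fdim_rhom => //.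
exact: lfd_proj_rep.
Qed.

End Nakayama.

(** * Extensions and almost split sequences *)

Section Extensions.
Context (k : fieldType) (Q : quiver).
Implicit Types M N L X Y Z P : repn k Q.

Section Twist.
Variables (Z M : repn k Q) (c : forall x y, arrow x y -> {linear M x -> Z y}).

Lemma twist_act_linear x y (a : arrow x y) :
  linear (fun v : Z x * M x => (act Z a v.1 + c a v.2, act M a v.2)).
Proof.
move=> t u v; congr (_, _); last by rewrite /= linearP.
by rewrite /= !linearP scalerDr addrACA.
Qed.

(* The extension of M by Z with cocycle c. *)
Definition twist : repn k Q :=
  @Repn k Q (fun x => (Z x * M x)%type)
    (fun x y a => mklin (@twist_act_linear x y a)).

Program Definition twist_inl : rhom Z twist :=
  @RHom k Q Z twist (fun x => mklin (f := fun v : Z x => (v, 0 : M x)) _) _.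
Next Obligation. by move=> x t u v; congr (_, _); rewrite /= scaler0 addr0. Qed.
Next Obligation. by move=> x y a v; congr (_, _); rewrite /= ?linear0 ?addr0. Qed.

Program Definition twist_snd : rhom twist M :=
  @RHom k Q twist M (fun x => mklin (f := fun v : Z x * M x => v.2) _) _.
Next Obligation. by []. Qed.
Next Obligation. by []. Qed.

Lemma twist_short_exact : short_exact twist_inl twist_snd.
Proof.
split=> [x u v []//|x [u v]|x v]; last by exists (0, v).
by split=> [/= ->|[w [_ <-]]//]; exists u.
Qed.

End Twist.

Lemma epi_cancel M N L (q : rhom M N) (f g : rhom N L) : is_epi q ->
  f ** q = g ** q -> f = g.
Proof.
move=> qe fg; apply: rhom_ext => x v.
by have [u <-] := qe x v; exact: (rhomE u fg).
Qed.

Lemma mono_cancel M N L (i : rhom N L) (f g : rhom M N) : is_mono i ->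
  i ** f = i ** g -> f = g.
Proof.
by move=> im fg; apply: rhom_ext => x v; apply: im; exact: (rhomE v fg).
Qed.

Lemma kernel_lift X N M Z (f : rhom X N) (g : rhom N M) (h : rhom Z N) :
  is_mono f -> exact_at f g -> g ** h = 0 -> exists h', f ** h' = h.
Proof.
move=> fm fg gh; apply: lift_mono => // x v.
by apply/fg; exact: (rhomE v gh).
Qed.

Lemma cokernel_lift X N M Z (f : rhom X N) (g : rhom N M) (h : rhom N Z) :
  exact_at f g -> is_epi g -> h ** f = 0 -> exists h', h' ** g = h.
Proof.
by move=> fg ge hf; apply: lift_epi => // x _ /fg[v <-]; exact: (rhomE v hf).
Qed.

Lemma exact_comp X N M (f : rhom X N) (g : rhom N M) : exact_at f g -> g ** f = 0.
Proof. by move=> fg; apply: rhom_ext => x v; apply/fg; exists v. Qed.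

Lemma rcomp0 M N L (g : rhom N L) : g ** (0 : rhom M N) = 0.
Proof. by apply: rhom_ext => x v /=; rewrite linear0. Qed.

Lemma rcomp0l M N L (f : rhom M N) : (0 : rhom N L) ** f = 0.
Proof. exact: rhom_ext. Qed.

Lemma rcompBl M N L (f : rhom M N) (g h : rhom N L) :
  (g - h) ** f = g ** f - h ** f.
Proof. exact: rhom_ext. Qed.

Lemma rcompBr M N L (f g : rhom M N) (h : rhom N L) :
  h ** (f - g) = h ** f - h ** g.
Proof. by apply: rhom_ext => x v /=; rewrite linearB. Qed.

(* Since the extensions of P/N are given by arbitrary cocycles, they lift along *)
(* p : X -> Y. Concretely, [g r] (r a vertexwise retraction of i) fails to be a *)
(* morphism by a cocycle [psi] vanishing on N; a splitting of the extension of  *)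
(* P by X with cocycle [phi], a lift of [psi], corrects this failure.           *)
Lemma hereditary N P (i : rhom N P) : lfd P -> is_mono i -> is_projective P ->
  is_projective N.
Proof.
move=> fP im pP X Y p g fX fY pe.
pose r x := projT1 (cid (fdim_retraction (fP x) (im x))).
have rK x n : r x (i x n) = n by rewrite /r; case: cid.
pose s x := projT1 (cid (fdim_section (fY x) (pe x))).
have sK x v : p x (s x v) = v by rewrite /s; case: cid.
pose psi x y (a : arrow x y) : {linear P x -> Y y} :=
  (g y \o r y \o act P a) \- (act Y a \o (g x \o r x)).
pose phi x y (a : arrow x y) : {linear P x -> X y} := s y \o psi x y a.
have [_ _ te] := twist_short_exact phi.
have [sg sgE] := pP _ _ (twist_snd phi) (rid P) (lfd_rsum fX fP) fP te.
have sg2 x v : (sg x v).2 = v by exact: (rhomE v sgE).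
pose t x : {linear P x -> X x} := mklin (f := fun v => (sg x v).1)
  (fun c u v => congr1 fst (linearP (sg x) c u v)).
have tE x y (a : arrow x y) v : t y (act P a v) = act X a (t x v) + phi x y a v.
  have := congr1 fst (rhom_act sg a v).
  rewrite -[LHS]/(t y (act P a v)).
  by rewrite -[RHS]/(act X a (t x v) + phi x y a (sg x v).2) sg2.
have hE x y (a : arrow x y) v :
  ((p y \o t y) \- (g y \o r y)) (act P a v) =
  act Y a (((p x \o t x) \- (g x \o r x)) v).
  rewrite -[LHS]/(p y (t y (act P a v)) - g y (r y (act P a v))).
  rewrite -[X in _ = act Y a X]/(p x (t x v) - g x (r x v)).
  rewrite tE linearD rhom_act linearB /= sK /psi /=.
  by rewrite addrCA addrC addrK.
pose h : rhom P Y := RHom hE.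
have [h' ph'] := pP _ _ p h fX fY pe.
have kE x y (a : arrow x y) v :
  ((t y \- h' y) \o i y) (act N a v) = act X a (((t x \- h' x) \o i x) v).
  have tE2 : t y (i y (act N a v)) = act X a (t x (i x v)).
    rewrite rhom_act tE /phi /psi /= -(rhom_act i) !rK rhom_act subrr.
    by rewrite linear0 addr0.
  rewrite -[LHS]/(t y (i y (act N a v)) - h' y (i y (act N a v))) tE2.
  by rewrite -[RHS]/(act X a (t x (i x v) - h' x (i x v))) linearB !rhom_act.
exists (RHom kE); apply: rhom_ext => x v /=; rewrite linearB.
rewrite -[p x (h' x _)]/((p ** h') x (i x v)) ph' /= rK.
by rewrite opprB addrC subrK.
Qed.

Lemma projective_retract M P (e : rhom P M) (s : rhom M P) : e ** s = rid M ->
  is_projective P -> is_projective M.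
Proof.
move=> es pP X Y p f fX fY pe; have [g gE] := pP _ _ p (f ** e) fX fY pe.
by exists (g ** s); rewrite rcompA gE -rcompA es rcomp1.
Qed.

(** The image of [f] is projective, being a subobject of [P], so [M] retracts onto it. Were it
    nonzero, [M] would be isomorphic to it and hence projective. *)
Lemma hom_proj_zero M P (f : rhom M P) : lfd M -> lfd P -> is_projective P ->
  indecomposable M -> ~ is_projective M -> f = 0.
Proof.
move=> fM fP pP iM npM; have [R [e [i [ee im <-]]]] := image_exists f.
have fR := lfd_mono im fP; have pR := hereditary fP im pP.
have [s es] := pR _ _ e (rid R) fM fR ee.
have er : retraction e by exists s.
have [ei|R0] := indecomposable_retraction fM iM er; last first.
  by apply: rhom_ext => x v; rewrite /= (R0 x (e x v)) linear0.
by case: npM; case: ei => g [ge _]; exact: projective_retract ge pR.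
Qed.

Lemma pullback X A B M (i : rhom X A) (q : rhom A B) (u : rhom M B) :
  is_kernel i q -> is_epi q -> lfd A -> lfd M ->
  exists N (f : rhom X N) (g : rhom N M) (al : rhom N A),
    [/\ short_exact f g, lfd N, al ** f = i, q ** al = u ** g &
    forall Z (w : rhom Z A) (m : rhom Z M), q ** w = u ** m ->
      exists h, g ** h = m].
Proof.
move=> [im ie] qe fA fM.
have [N [j [jm je]]] := kernel_exists (q ** rfst A M - u ** rsnd A M).
have jE Z (h : rhom Z (rsum A M)) :
    q ** (rfst A M ** h) = u ** (rsnd A M ** h) -> exists h', j ** h' = h.
  move=> E; apply: (kernel_lift jm je); rewrite rcompBl -!rcompA E.
  exact: subrr.
have jE2 : q ** (rfst A M ** j) = u ** (rsnd A M ** j).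
  apply/eqP; rewrite -subr_eq0 !rcompA -rcompBl.
  by apply/eqP; exact: exact_comp je.
have jK x n : j x n = ((rfst A M ** j) x n, (rsnd A M ** j) x n).
  by rewrite /=; case: (j x n).
have [|f fE] := jE _ (rinl A M ** i).
  apply: rhom_ext => x v; rewrite /= linear0.
  by apply/ie; exists v.
have fE' x v : j x (f x v) = (i x v, 0) := rhomE v fE.
exists N, f, (rsnd A M ** j), (rfst A M ** j); split=> //.
- split.
  + move=> x v w vw; apply: im.
    by have := congr1 fst (fE' x v); rewrite vw fE'.
  + move=> x n; split=> [n0|[v <-]]; last first.
      by rewrite /= fE'.
    have /ie[v vE] : q x ((rfst A M ** j) x n) = 0.
      have /= -> := rhomE n jE2.
      by rewrite -[(j x n).2]/((rsnd A M ** j) x n) n0 linear0.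
    exists v; apply: jm; rewrite fE' jK vE; congr (_, _); exact: esym.
  + move=> x m; have [a aE] := qe x (u x m).
    have /je[n nE] : (q ** rfst A M - u ** rsnd A M) x (a, m) = 0.
      by rewrite /= aE subrr.
    by exists n; rewrite /= nE.
- by apply: lfd_mono jm _; exact: lfd_rsum.
- by rewrite -rcompA fE; exact: rhom_ext.
- move=> Z w m wm; have [|h hE] := jE _ (rinl A M ** w + rinr A M ** m).
    have -> : rfst A M ** (rinl A M ** w + rinr A M ** m) = w.
      by apply: rhom_ext => x v; rewrite /= addr0.
    by rewrite wm; congr (_ ** _); apply: rhom_ext => x v; rewrite /= add0r.
  exists h; rewrite -rcompA hE; apply: rhom_ext => x v.
  by rewrite /= add0r.
Qed.

Lemma riter_comm M N (a : rhom M M) (b : rhom N N) (q : rhom M N) n :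
  q ** a = b ** q -> q ** riter a n = riter b n ** q.
Proof.
move=> E; elim: n => [|n IH] /=; first by rewrite rcomp1 rcomp1l.
by rewrite rcompA E -rcompA IH rcompA.
Qed.

Lemma riter_fix M N (a : rhom M M) (q : rhom M N) n :
  q ** a = q -> q ** riter a n = q.
Proof. by move=> E; elim: n => [|n IH]; rewrite /= ?rcomp1 // rcompA E. Qed.

(** If [r] retracts [f], then 1 - f r kills [f] and so factors through [g], by a section of [g]. *)
Lemma section_split X N M (f : rhom X N) (g : rhom N M) :
  short_exact f g -> section_hom f -> retraction g.
Proof.
move=> [fm fg ge] [r rf].
have [|s sE] := @cokernel_lift _ _ _ _ f g (rid N - f ** r) fg ge.
  by rewrite rcompBl -rcompA rf rcomp1 rcomp1l subrr.
exists s; apply: (epi_cancel ge).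
by rewrite -rcompA sE rcompBr rcompA (exact_comp fg) rcomp0l subr0 rcomp1 rcomp1l.
Qed.

Section AlmostSplit.
Variables (X N M : repn k Q) (f : rhom X N) (g : rhom N M).
Hypotheses (fX : lfd X) (fN : lfd N) (fM : lfd M) (fg : short_exact f g).
Hypotheses (gmin : right_minimal g) (gsplit : right_almost_split g).

Let fm : is_mono f. Proof. by case: fg. Qed.
Let fge : exact_at f g. Proof. by case: fg. Qed.
Let ge : is_epi g. Proof. by case: fg. Qed.
Let f_nsection : ~ section_hom f.
Proof. by move=> /(section_split fg); case: gsplit. Qed.

(** [h] induces h' on [M]. If h' is invertible, [h] is injective, hence invertible. Otherwise h' is
    not even a retraction, so it lifts to [s] with g s = h'; then h - s g maps into [X] and gives a
    retraction of [f], which is impossible. *)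
Lemma left_minimal_of_right : left_minimal f.
Proof.
move=> h hf.
have [|h' h'E] := @cokernel_lift _ _ _ _ f g (g ** h) fge ge.
  by rewrite -rcompA hf (exact_comp fge).
have [h'i|h'n] := pselect (is_iso h').
  apply: endo_mono_iso => // x u v uv; apply/eqP; rewrite -subr_eq0.
  have h0 : h x (u - v) = 0 by rewrite linearB uv subrr.
  have /fge[w wE] : g x (u - v) = 0.
    apply: (is_iso_mono h'i); rewrite linear0.
    by have /= -> := rhomE (u - v) h'E; rewrite h0 linear0.
  move: h0; rewrite -wE; have /= -> := rhomE w hf.
  by move=> ->.
have h'r : ~ retraction h'.
  by move=> /retraction_epi h'e; apply: h'n; exact: endo_epi_iso.
have [s sE] := gsplit.2 _ h' fM h'r.
have [|r rE] := @kernel_lift _ _ _ _ f g (h - s ** g) fm fge.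
  by rewrite rcompBr rcompA sE h'E subrr.
case: f_nsection; exists r; apply: (mono_cancel fm).
by rewrite rcompA rE rcompBl hf -rcompA (exact_comp fge) rcomp0 subr0 rcomp1.
Qed.

(* The pushout of f along t is the twisted sum of Z and M whose cocycle is the  *)
(* image under t of a cocycle of the given sequence.                            *)
Lemma left_almost_split_of_right : left_almost_split f.
Proof.
split=> // Z t fZ tns.
pose s x := projT1 (cid (fdim_section (fM x) (@ge x))).
have sK x v : g x (s x v) = v by rewrite /s; case: cid.
pose r x := projT1 (cid (fdim_retraction (fN x) (@fm x))).
have rK x v : r x (f x v) = v by rewrite /r; case: cid.
have frK x n : g x n = 0 -> f x (r x n) = n by case/fge=> v <-; rewrite rK.
(* [z] measures how far the vertexwise section [s] is from commuting with the arrows: a cocycle of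
   the sequence. Below, [rho] and [g] are the resulting vertexwise coordinates of [N] on [X] and
   [M]. *)
pose z x y (a : arrow x y) : {linear M x -> X y} :=
  r y \o ((act N a \o s x) \- (s y \o act M a)).
have zE x y (a : arrow x y) m :
    f y (z x y a m) = act N a (s x m) - s y (act M a m).
  by rewrite /z /= frK // linearB rhom_act !sK subrr.
pose rho x : {linear N x -> X x} := r x \o (idfun \- (s x \o g x)).
have rhoE x n : f x (rho x n) = n - s x (g x n).
  by rewrite /rho /= frK // linearB sK subrr.
have rhoA x y (a : arrow x y) n :
    rho y (act N a n) = act X a (rho x n) + z x y a (g x n).
  apply: fm; rewrite linearD rhom_act !rhoE zE linearB rhom_act.
  by rewrite addrA subrK.
pose c x y (a : arrow x y) : {linear M x -> Z y} := t y \o z x y a.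
have [tm te tse] := twist_short_exact c.
pose T := twist c.
have bl x : linear (fun n : N x => (t x (rho x n), g x n) : T x).
  by move=> d u v; congr (_, _); rewrite !linearP.
have ba x y (a : arrow x y) n :
    mklin (bl y) (act N a n) = act T a (mklin (bl x) n).
  congr (_, _); last exact: rhom_act.
  by rewrite -[LHS]/(t y (rho y (act N a n))) rhoA linearD rhom_act.
pose b : rhom N T := RHom ba.
have gb : twist_snd c ** b = g by exact: rhom_ext.
have bf : b ** f = twist_inl c ** t.
  apply: rhom_ext => x v; congr (_, _); last by apply/fge; exists v.
  congr (t x _); apply: fm; rewrite rhoE.
  have -> : g x (f x v) = 0 by apply/fge; exists v.
  by rewrite linear0 subr0.
(* If the pushout splits, [t] extends along [f]. Otherwise T -> M lifts to h : T -> N; then [h b] is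
   an endomorphism of [N] over [M], invertible by right minimality, and its inverse turns [h] into a
   retraction of [t]. *)
have [[sg sgE]|nr] := pselect (retraction (twist_snd c)).
  have [|h hE] := kernel_lift (h := b - sg ** g) tm te.
    by rewrite rcompBr rcompA sgE gb rcomp1l subrr.
  exists h; apply: (mono_cancel tm).
  by rewrite rcompA hE rcompBl bf -(rcompA sg) (exact_comp fge) rcomp0 subr0.
have fT : lfd T by move=> x; exact: fdim_prod.
have [h hE] := gsplit.2 T _ fT nr.
have gpsi : g ** (h ** b) = g by rewrite rcompA hE.
have [psi' [E1 E2]] := gmin gpsi.
have gpsi' : g ** psi' = g by rewrite -{1}gpsi -rcompA E2 rcomp1.
have [|s1 s1E] := @kernel_lift _ _ _ _ f g (psi' ** (h ** twist_inl c)) fm fge.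
  by rewrite rcompA gpsi' rcompA hE (exact_comp te).
case: tns; exists s1; apply: (mono_cancel fm).
by rewrite rcompA s1E -!rcompA -bf (rcompA h) rcompA E1 rcomp1l rcomp1.
Qed.

Lemma almost_split_of_right : almost_split_sequence f g.
Proof.
split=> //; split=> //; first exact: left_minimal_of_right.
exact: left_almost_split_of_right.
Qed.

End AlmostSplit.

End Extensions.

(** * The Auslander-Reiten sequence ending in M *)

Section AuslanderReitenSequence.
Context (k : fieldType) (Q : quiver).
Implicit Types M N L X Y Z P : repn k Q.

Lemma nakayama_map_comp M N L (g : rhom N L) (f : rhom M N) :
  nakayama_map (g ** f) = nakayama_map g ** nakayama_map f.
Proof.
apply: rhom_ext => x z; apply: linear_ext => h.
rewrite -[LHS]/((z : kdual _) (h ** (g ** f))).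
by rewrite -[RHS]/((z : kdual _) (h ** g ** f)) rcompA.
Qed.

Lemma nakayama_map_sub M N (f g : rhom M N) :
  nakayama_map (f - g) = nakayama_map f - nakayama_map g.
Proof.
apply: rhom_ext => x z; apply: linear_ext => h.
rewrite -[LHS]/((z : kdual _) (h ** (f - g))) rcompBr linearB.
exact: erefl.
Qed.

Lemma nakayama_map_id M : nakayama_map (rid M) = rid (nakayama M).
Proof.
apply: rhom_ext => x z; apply: linear_ext => h.
by rewrite -[LHS]/((z : kdual _) (h ** rid M)) rcomp1.
Qed.

Lemma nakayama_map_iter M (f : rhom M M) n :
  nakayama_map (riter f n) = riter (nakayama_map f) n.
Proof.
elim: n => [|n IH] /=; first exact: nakayama_map_id.
by rewrite nakayama_map_comp IH.
Qed.

Lemma rcomp_mono M N L (g : rhom N L) (f : rhom M N) :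
  is_mono (g ** f) -> is_mono f.
Proof. by move=> gf x u v uv; apply: gf; rewrite /= uv. Qed.

Lemma mono_rcomp M N L (g : rhom N L) (f : rhom M N) :
  is_mono g -> is_mono f -> is_mono (g ** f).
Proof. by move=> gm fm x u v /gm/fm. Qed.

Lemma epi_rcomp M N L (g : rhom N L) (f : rhom M N) :
  is_epi g -> is_epi f -> is_epi (g ** f).
Proof.
move=> ge fe x w; have [v <-] := ge x w; have [u <-] := fe x v.
by exists u.
Qed.

Lemma in_proj_projective P : in_proj P -> is_projective P.
Proof. by move=> iP X Y p f _ _; exact: in_proj_lift. Qed.

(** At [x], nu f is the dual of Hom(P0, P_x) -> Hom(P1, P_x). The kernel of this restriction map is
    Hom(M, P_x) = 0, and the dual of an injection is onto. *)
Lemma nakayama_epi P1 P0 M (f : rhom P1 P0) (p : rhom P0 M) :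
  interval_finite Q -> in_proj P1 -> in_proj P0 -> short_exact f p ->
  lfd M -> indecomposable M -> ~ is_projective M -> is_epi (nakayama_map f).
Proof.
move=> fQ i1 i0 [fm fp pe] fM iM npM x eta.
have fPx := lfd_proj_rep k x fQ.
have pPx : is_projective (proj_rep k x).
  apply: in_proj_projective; exists [:: x].
  apply: (biprod_isomorphic (i1 := rid _) (p1 := rid _) (i2 := 0) (p2 := 0)).
  - exact: rcomp1.
  - by apply: rhom_ext => y v; rewrite [RHS]thinmx0 [LHS]thinmx0.
  - by rewrite rcomp1 rcomp0 addr0.
have [|r rK] := @fdim_retraction _ _ _ (precomp (proj_rep k x) f)
    (fdim_rhom i1 fPx).
  move=> h h' hh; apply/eqP; rewrite -subr_eq0; apply/eqP.
  have [|g <-] := @cokernel_lift _ _ _ _ _ _ f p (h - h') fp pe.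
    by rewrite rcompBl; apply/eqP; rewrite subr_eq0; apply/eqP.
  by rewrite (hom_proj_zero g) ?rcomp0l.
exists (kdual_map r eta); apply: linear_ext => h.
rewrite -[LHS]/((eta : kdual _) (r (precomp _ f h))) rK.
exact: erefl.
Qed.

(** The non-isomorphisms form a subspace, from which the identity can be separated. Indeed, let [w]
    invert f + g: if [w f] is nilpotent, then a vector killed by [g] is fixed by [w f] and so is
    zero, whence [g] is injective; if [w f] is invertible, so is [f]. *)
Lemma local_functional M : lfd M -> indecomposable M -> fdim (rhom M M) ->
  exists t : kdual (rhom M M), t (rid M) != 0 /\
    forall f, ~ is_iso f -> t f = 0.
Proof.
move=> fM iM fE.
have addiso (f g : rhom M M) : is_iso (f + g) -> is_iso f \/ is_iso g.
  move=> [w [w1 w2]].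
  have wE x v : w x (f x v) + w x (g x v) = v.
    by rewrite -linearD; exact: (rhomE v w1).
  have [wf|[n wn]] := endo_iso_or_nilpotent (w ** f) fM iM fE.
    by left; apply: endo_mono_iso fM _; exact: rcomp_mono (is_iso_mono wf).
  right; apply: endo_mono_iso fM _ => x.
  apply: raddf_inj => v gv; have fv : (w ** f) x v = v.
    by have := wE x v; rewrite gv linear0 addr0.
  have : riter (w ** f) n x v = v by elim: (n) => //= m ->; exact: fv.
  by rewrite wn.
have [|c f g nf ng|nid|t [t1 t0]] :=
  @separation k _ (fun f : rhom M M => ~ is_iso f) (rid M) fE.
- case=> g [_ g0]; case: iM => + _; apply => x v.
  by have := rhomE v g0; rewrite /= => <-.
- case/addiso => // cf; apply: nf; apply: endo_mono_iso fM _ => x u v uv.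
  by apply: (is_iso_mono cf); rewrite /= uv.
- by apply: nid; exists (rid M); split; exact: rcomp1.
- by exists t.
Qed.

Section Sequence.
Variables (M P1 P0 X : repn k Q) (f : rhom P1 P0) (p : rhom P0 M).
Variable (i : rhom X (nakayama P1)).
Hypotheses (fQ : interval_finite Q) (fM : lfd M) (iM : indecomposable M).
Hypotheses (npM : ~ is_projective M) (fpmin : minimal_proj_resolution f p).
Hypothesis ik : is_kernel i (nakayama_map f).

Let i1 : in_proj P1. Proof. by case: fpmin. Qed.
Let i0 : in_proj P0. Proof. by case: fpmin. Qed.
Let fpe : short_exact f p. Proof. by case: fpmin. Qed.
Let pess : essential_epi p. Proof. by case: fpmin. Qed.
Let fm : is_mono f. Proof. by case: fpe. Qed.
Let fp : exact_at f p. Proof. by case: fpe. Qed.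
Let pe : is_epi p. Proof. by case: fpe. Qed.
Let im : is_mono i. Proof. by case: ik. Qed.
Let ie : exact_at i (nakayama_map f). Proof. by case: ik. Qed.
Let fP1 : lfd P1. Proof. exact: lfd_in_proj. Qed.
Let fP0 : lfd P0. Proof. exact: lfd_in_proj. Qed.
Let fN1 : lfd (nakayama P1). Proof. exact: lfd_nakayama. Qed.
Let fX : lfd X. Proof. exact: lfd_mono im fN1. Qed.
Let fE : fdim (rhom M M).
Proof. by apply: fdim_rhom_epi pe _; exact: fdim_rhom. Qed.
Let nfe : is_epi (nakayama_map f). Proof. exact: nakayama_epi fpe _ _ _. Qed.

Lemma DTr_short_exact : short_exact i (nakayama_map f).
Proof. by split. Qed.

Lemma DTr_endo N (f' : rhom X N) (g : rhom N M) (psi : rhom N N) :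
  short_exact f' g -> lfd N -> ~ retraction g -> g ** psi = g -> is_iso psi.
Proof.
move=> [f'm fg ge] fN ng gpsi.
have [|chi chiE] := @kernel_lift _ _ _ _ _ _ f' g (psi ** f') f'm fg.
  by rewrite rcompA gpsi (exact_comp fg).
(* The restriction [chi] of [psi] to [X] extends to [w1] on nu P1 by injectivity and induces [w0] on
   the cokernel nu P0. Full faithfulness turns these into a commuting pair [s1], [s0], which induces
   [mu] on [M]. *)
have [w1 w1E] := nakayama_injective (i ** chi) i1 fN1 im.
have [|w0 w0E] := @cokernel_lift _ _ _ _ _ _ i (nakayama_map f)
    (nakayama_map f ** w1) ie nfe.
  by rewrite -rcompA w1E rcompA (exact_comp ie) rcomp0l.
have [s1 s1E] := nakayama_full w1 i1 i1 fP1.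
have [s0 s0E] := nakayama_full w0 i0 i0 fP0.
have sf : s0 ** f = f ** s1.
  apply/eqP; rewrite -subr_eq0; apply/eqP; apply: (nakayama_faithful i1 i0 fQ).
  by rewrite nakayama_map_sub !nakayama_map_comp s0E s1E w0E subrr.
have [|mu muE] := @cokernel_lift _ _ _ _ _ _ f p (p ** s0) fp pe.
  by rewrite -rcompA sf rcompA (exact_comp fp) rcomp0l.
have [mui|[n mun]] := endo_iso_or_nilpotent mu fM iM fE.
  (* As [p s0 = mu p] is onto and [p] is essential, [s0] is onto, hence invertible. Injectivity then
     passes in turn to [s1], [w1], [chi] and [psi]. *)
  have s0m : is_mono s0.
    apply: is_iso_mono; apply: endo_epi_iso fP0 _; apply: (pess.2 _ _ fP0).
    by rewrite -muE; apply: epi_rcomp pe; exact: is_iso_epi.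
  have s1i : is_iso s1.
    apply: endo_mono_iso fP1 _; apply: (@rcomp_mono _ _ _ f).
    by rewrite -sf; exact: mono_rcomp s0m fm.
  have w1m : is_mono w1.
    case: s1i => s1' [s1's _]; apply: (@rcomp_mono _ _ _ (nakayama_map s1')).
    by rewrite -s1E -nakayama_map_comp s1's nakayama_map_id => x u v.
  have chim : is_mono chi.
    by apply: (@rcomp_mono _ _ _ i); rewrite -w1E; exact: mono_rcomp w1m im.
  apply: endo_mono_iso fN _ => x; apply: raddf_inj => v psiv.
  have /fg[u uE] : g x v = 0 by rewrite -gpsi /= psiv linear0.
  have : (f' ** chi) x u = 0 by rewrite chiE /= uE.
  rewrite -[RHS](linear0 (f' x)) => /f'm.
  by rewrite -[RHS](linear0 (chi x)) => /chim u0; rewrite -uE u0 linear0.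
(* Now mu^n = 0, so s0^n maps into the kernel of [p]: s0^n = f h, and then s1^n = h f. Hence
   nu(s1^n) vanishes on [X], that is, chi^n = 0, so psi^n = s g for some [s]. Since g psi^n = g,
   this [s] would be a section of [g]. *)
have [|h hE] := @kernel_lift _ _ _ _ _ _ f p (riter s0 n) fm fp.
  by rewrite (riter_comm n (esym muE)) mun rcomp0l.
have h1E : riter s1 n = h ** f.
  by apply: (mono_cancel fm); rewrite (riter_comm n (esym sf)) -hE rcompA.
have chin : riter chi n = 0.
  apply: (mono_cancel im); rewrite (riter_comm n (esym w1E)) -s1E.
  by rewrite -nakayama_map_iter h1E nakayama_map_comp -rcompA (exact_comp ie) !rcomp0.
have [|s sE] := @cokernel_lift _ _ _ _ _ _ f' g (riter psi n) fg ge.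
  by rewrite -(riter_comm n chiE) chin rcomp0.
case: ng; exists s; apply: (epi_cancel ge).
by rewrite -rcompA sE (riter_fix n gpsi) rcomp1l.
Qed.

Lemma DTr_almost_split : exists N (f' : rhom X N) (g : rhom N M),
  almost_split_sequence f' g.
Proof.
have [t [t1 t0]] := local_functional fM iM fE.
have fH0M := fdim_rhom i0 fM.
(* A linear retraction of the injection End(M) -> Hom(P0, M), composition with [p]; it extends the
   functional [t] to [t']. *)
have [|r rK] := @fdim_retraction _ _ _ (precomp M p) fH0M.
  by move=> h h'; exact: epi_cancel.
pose t' : kdual (rhom P0 M) := kdual_map r t.
have t'E h : t' (h ** p) = t h.
  by rewrite -[LHS]/(t (r (precomp M p h))) rK.
have [T1 [b1]] := in_proj_dual_basis i1.
have [T0 [b0]] := in_proj_dual_basis i0.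
have [N [f' [g [al [fg fN alf alg lift]]]]] :=
  pullback (nakayama_pairing t') ik nfe fN1 fM.
exists N, f', g.
have ng : ~ retraction g.
  (* A section [s] gives al s : M -> nu P1, that is, a functional [eta] on Hom(P1, M) with t'(phi) =
     eta(phi f). Then t(1) = t'(p) = eta(p f) = 0, a contradiction. *)
  case=> s gs; have [eta etaE] := nakayama_pairing_surj b1 (al ** s).
  have E : kdual_map (precomp M f) eta = t'.
    apply: (nakayama_pairing_inj b0); rewrite -nakayama_pairing_mapl etaE.
    by rewrite rcompA alg -rcompA gs rcomp1.
  move/eqP: t1; rewrite -t'E -E rcomp1l; apply.
  by rewrite -[LHS]/(eta (p ** f)) (exact_comp fp) linear0.
apply: almost_split_of_right => //.
  by move=> psi; exact: DTr_endo fg fN ng.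
split=> // Z g0 fZ ng0.
(* If phi f = 0, then phi = phi' p and kap(phi) = t(g0 phi') = 0, because g0 phi' cannot be
   invertible when [g0] is not a retraction. So [kap] factors through restriction along [f]; the
   factor [eta] gives Z -> nu P1 and thus the lift to [N]. *)
pose kap : kdual (rhom P0 Z) := kdual_map (postcomp P0 g0) t'.
have [|eta etaE] := @factor_linear _ _ _ _ (precomp Z f) kap
   (fdim_rhom i0 fZ) (fdim_rhom i1 fZ).
  move=> phi phif; have [phi' <-] := cokernel_lift fp pe phif.
  rewrite -[LHS]/(t' (g0 ** (phi' ** p))) rcompA t'E t0 //.
  by case=> s [_ gs]; apply: ng0; exists (phi' ** s); rewrite rcompA.
have [|h hE] := lift Z (nakayama_pairing (eta : kdual (rhom P1 Z))) g0.
  rewrite nakayama_pairing_mapl nakayama_pairing_mapr; congr nakayama_pairing.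
  exact: linear_ext.
by exists h.
Qed.

End Sequence.

End AuslanderReitenSequence.

(** * Minimal projective resolutions *)

Section Acyclic.
Context (Q : quiver).

Fixpoint plength (x y : Q) (r : qpath x y) : nat :=
  if r is qpath_post _ _ s _ then (plength s).+1 else 0.

Fixpoint qpath_cat (x y z : Q) (r : qpath x y) (s : qpath y z) : qpath x z :=
  match s in qpath _ z return qpath x z with
  | qpath_triv => r
  | qpath_post _ _ s' a => qpath_post (qpath_cat r s') a
  end.

Lemma plength_cat (x y z : Q) (r : qpath x y) (s : qpath y z) :
  plength (qpath_cat r s) = (plength r + plength s)%N.
Proof. by elim: s => [|z' z'' s IH a] /=; rewrite ?addn0 // IH addnS. Qed.

(** The powers of a nontrivial cycle would be arbitrarily long paths in a finite set. *)
Lemma plength_cycle (x : Q) (r : qpath x x) : interval_finite Q ->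
  plength r = 0%N.
Proof.
move=> fQ; apply/eqP; rewrite -leqn0 leqNgt; apply/negP => r0.
have [s sE] := (finite_seqP _).1 (fQ x x).
pose n := \max_(q <- s) plength q.
pose c := iter n.+1 (fun q => qpath_cat q r) (qpath_triv x).
have cs : c \in s by have : setT c by []; rewrite sE.
have : (plength c <= n)%N by rewrite /n; exact: leq_bigmax_seq.
suff -> : plength c = (n.+1 * plength r)%N by rewrite leqNgt leq_pmulr.
rewrite /c; elim: n.+1 => // m IH.
by rewrite iterS plength_cat IH mulSn addnC.
Qed.

Lemma plength0 (x y : Q) (r : qpath x y) : plength r = 0%N ->
  exists e : x = y, r = ecast y (qpath x y) e (qpath_triv x).
Proof. by case: r => // _; exists erefl. Qed.

(** Reachability is thus a partial order on the vertices; the induction in [projective_cover] runs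
    along it. *)
Lemma qpath_antisym (x y : Q) : interval_finite Q ->
  qpath x y -> qpath y x -> x = y.
Proof.
move=> fQ r s; have := plength_cycle (qpath_cat r s) fQ.
rewrite plength_cat => /eqP; rewrite addn_eq0 => /andP[/eqP r0 _].
by have [] := plength0 r0.
Qed.

Lemma qpath_loop (x : Q) (r : qpath x x) : interval_finite Q ->
  r = qpath_triv x.
Proof.
move=> fQ; have [e ->] := plength0 (plength_cycle r fQ).
by rewrite (Prop_irrelevance e erefl).
Qed.

End Acyclic.

(** * Projective covers over an interval-finite quiver *)

Section ProjectiveCovers.
Context (k : fieldType) (Q : quiver).
Implicit Types M N L X Y Z P : repn k Q.

Lemma freeg_neq0 (K : choiceType) (c : {freeg K / k}) : c <> 0 ->
  inhabited K.
Proof.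
move=> c0; apply: contrapT => nK; apply: c0; apply/eqP/freeg_eqP => x.
by case: nK.
Qed.

(** A nonzero [c] provides a path from [x] to [y], so [x = y]. There P_x(x) is spanned by the
    trivial path, and [c] is a nonzero scalar. *)
Lemma proj_rep_unit (x y : Q) (c : proj_rep k x y) : interval_finite Q ->
  c <> 0 -> qpath y x -> exists d, yoneda c x d = triv k x.
Proof.
move=> fQ c0 s; have [r] := freeg_neq0 c0.
have xy := qpath_antisym fQ r s; subst y.
have cE : c = coeff (qpath_triv x) c *: triv k x.
  apply/eqP/freeg_eqP => q; rewrite coeffZ coeffU (qpath_loop q fQ) eqxx.
  by rewrite mulr1 mulr1.
have l0 : coeff (qpath_triv x) c != 0.
  by apply/eqP => l0; apply: c0; rewrite cE l0 scale0r.
exists ((coeff (qpath_triv x) c)^-1 *: triv k x).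
by rewrite linearZ_LR yoneda_triv [X in _ *: X]cE scalerA mulVf // scale1r.
Qed.

(** The morphism from the sum of the P_a that sends the trivial paths to the listed elements. *)
Fixpoint gen M (s : seq {a : Q & M a}) : rhom (psum k (map tag s)) M :=
  match s return rhom (psum k (map tag s)) M with
  | [::] => 0
  | t :: s' => yoneda (tagged t) ** rfst (proj_rep k (tag t)) (psum k (map tag s'))
               + gen s' ** rsnd (proj_rep k (tag t)) (psum k (map tag s'))
  end.

Definition spanned M (s : seq {a : Q & M a}) x (v : M x) :=
  exists w, gen s x w = v.

Lemma spannedD M (s : seq {a : Q & M a}) x c (u v : M x) :
  spanned s u -> spanned s v -> spanned s (c *: u + v).
Proof. by move=> [u' <-] [v' <-]; exists (c *: u' + v'); rewrite linearP. Qed.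

Lemma spanned_sum M (s : seq {a : Q & M a}) x (I : finType) (P : pred I)
    (F : I -> M x) :
  (forall i, P i -> spanned s (F i)) -> spanned s (\sum_(i | P i) F i).
Proof.
move=> H; elim/big_rec: _ => [|i v Pi sv]; first by exists 0; rewrite linear0.
by rewrite -[F i]scale1r; apply: spannedD => //; exact: H.
Qed.

Lemma spanned_yoneda M (s : seq {a : Q & M a}) x y (v : M x) (c : proj_rep k x y) :
  spanned s v -> spanned s (yoneda v y c).
Proof. by move=> [w <-]; exists (yoneda w y c); rewrite -yoneda_comp. Qed.

Lemma spanned_mem M (I : eqType) (r : seq I) (F : I -> {a : Q & M a}) i :
  i \in r -> spanned (map F r) (tagged (F i)).
Proof.
elim: r => // j r IH; rewrite inE => /predU1P[->|/IH[w wE]].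
  exists (triv k (tag (F j)), 0).
  rewrite -[LHS]/(yoneda (tagged (F j)) _ (triv k (tag (F j)))
    + gen (map F r) _ 0) yoneda_triv.
  by rewrite linear0 addr0.
exists (0, w); rewrite -[RHS]wE.
rewrite -[LHS]/(yoneda (tagged (F j)) _ 0 + gen (map F r) _ w).
by rewrite linear0 add0r.
Qed.

Definition finitely_generated M := exists s : seq {a : Q & M a}, is_epi (gen s).

Lemma dual_basis_generate P T (b : dual_basis P T) M (p : rhom P M) :
  is_epi p -> finitely_generated M.
Proof.
move=> pe; pose F t : {a : Q & M a} := Tagged (fun a => M a) (p _ (db_elt b t)).
exists (map F (enum T)) => x v; have [u <-] := pe x v.
rewrite -[u](db_sumE b) linear_sum; apply: spanned_sum => t _.
rewrite -[p x _]/((p ** yoneda (db_elt b t)) x (db_coord b t x u)) yoneda_comp.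
apply: spanned_yoneda.
by have := @spanned_mem M T (enum T) F t; rewrite mem_enum; exact.
Qed.

(* A generating family s of minimal size works: if some generator e_t is not in *)
(* the image U of h, take t minimal for the path order and write e_t = u + kap  *)
(* with u in U and kap in the kernel of p. By minimality of s, kap only         *)
(* involves generators strictly below t, so it lies in U, a contradiction.      *)
Lemma projective_cover M : interval_finite Q -> finitely_generated M ->
  exists s : seq {a : Q & M a}, essential_epi (gen s).
Proof.
move=> fQ [s0 s0e].
pose ok n := `[< exists s : seq {a : Q & M a}, size s = n /\ is_epi (gen s) >].
have ok0 : exists n, ok n by exists (size s0); apply/asboolP; exists s0.
case: (ex_minnP ok0) => n /asboolP[s [sn pe]] minn; exists s; split=> // X h fX phe.
have [T [b] cT] := psum_dual_basis k (map tag s).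
have {}cT : #|T| = n by rewrite cT size_map.
set p := gen s in pe phe *; set P := psum k (map tag s) in p b h pe phe *.
pose vt := db_vertex b; pose e t : P (vt t) := db_elt b t.
pose U x (v : P x) := exists u, h x u = v.
have UD x (u v : P x) : U x u -> U x v -> U x (u + v).
  by move=> [u' <-] [v' <-]; exists (u' + v'); rewrite linearD.
have Usum x (F : T -> P x) : (forall t, U x (F t)) -> U x (\sum_t F t).
  move=> H; elim/big_rec: _ => [|i v _ Uv]; first by exists 0; rewrite linear0.
  exact: UD.
have Uy x y (v : P x) (c : proj_rep k x y) : U x v -> U y (yoneda v y c).
  by move=> [u <-]; exists (yoneda u y c); rewrite -yoneda_comp.
pose below t := [set t' | `[< inhabited (qpath (vt t') (vt t)) >]].
suff Ue t : U _ (e t).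
  by move=> x v; rewrite -/(U x v) -(db_sumE b v); apply: Usum => t; exact: Uy.
move: {2}(#|below t|).+1 (ltnSn #|below t|) => m.
elim: m t => // m IH t; rewrite ltnS => tm.
have [u uE] := phe _ (p _ (e t)).
pose kap := e t - h _ u.
have pkap : p _ kap = 0 by rewrite linearB -uE subrr.
suff Ukap : U _ kap by rewrite -[e t](subrK (h _ u)); apply: UD => //; exists u.
rewrite -(db_sumE b kap); apply: Usum => i; set c := db_coord b i _ kap.
have [->|c0] := pselect (c = 0); first by exists 0; rewrite !linear0.
have [r] := freeg_neq0 c0.
have [[r']|nr'] := pselect (inhabited (qpath (vt t) (vt i))); last first.
  apply: Uy; apply: IH; apply: leq_trans tm; apply: proper_card.
  apply/properP; split.
    apply/fintype.subsetP => j; rewrite !finset.inE => /asboolP[q].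
    apply/asboolP.
    by split; exact: qpath_cat q r.
  exists t; rewrite finset.inE; last by apply/negP => /asboolP.
  by apply/asboolP; split; exact: qpath_triv.
(* Each of the vertices of [i] and [t] reaches the other, so they coincide and [c] is a unit. Then
   p(kap) = 0 expresses the generator p(e_i) through the others, and dropping it contradicts
   minimality. *)
have [d dE] := proj_rep_unit fQ c0 r'.
pose F j : {a : Q & M a} := Tagged (fun a => M a) (p _ (e j)).
pose s' := map F (enum (predC1 i)).
have spE j y (w : proj_rep k (vt j) y) : j != i ->
    spanned s' (p y (yoneda (e j) y w)).
  move=> ji; rewrite -[p y _]/((p ** yoneda (e j)) y w) yoneda_comp.
  apply: spanned_yoneda.
  by have := @spanned_mem M T (enum (predC1 i)) F j; rewrite mem_enum; exact.
have spi : spanned s' (p _ (e i)).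
  have -> : p _ (e i) = yoneda (p _ (yoneda (e i) _ c)) _ d.
    rewrite -[in LHS](yoneda_triv (e i)) -dE.
    by rewrite -!yoneda_comp.
  apply: spanned_yoneda.
  have := pkap; rewrite -(db_sumE b kap) (bigD1 i) //= linearD.
  move/eqP; rewrite addr_eq0 => /eqP->; rewrite -scaleN1r -[_ *: _]addr0.
  apply: spannedD; last by exists 0; rewrite linear0.
  by rewrite linear_sum; apply: spanned_sum => j ji; exact: spE.
have : ok (size s').
  apply/asboolP; exists s'; split=> // x v; have [w <-] := pe x v.
  rewrite -/(spanned s' (p x w)) -(db_sumE b w) linear_sum.
  apply: spanned_sum => j _.
  have [->|ji] := eqVneq j i; last exact: spE.
  rewrite -[p x _]/((p ** yoneda (e i)) x (db_coord b i x w)) yoneda_comp.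
  exact: spanned_yoneda.
move=> /minn; rewrite size_map -cardE cardC1 cT.
by rewrite -cT (cardD1 i) inE /= ltnn.
Qed.

Lemma in_proj_psum (l : seq Q) : in_proj (psum k l).
Proof. by exists l; exact: isomorphic_refl. Qed.

(** Only the kernel [K] of the projective cover of [M] has to be shown to lie in proj(Q). It is
    projective, and finitely generated by comparison with the given resolution. *)
Lemma minimal_proj_resolution_exists M : interval_finite Q -> lfd M ->
  in_rep_plus M ->
  exists P1 P0 (f : rhom P1 P0) (p : rhom P0 M), minimal_proj_resolution f p.
Proof.
move=> fQ fM [P1' [P0' [f' [p' [i1' i0' [f'm f'p' p'e]]]]]].
have [T1 [b1]] := in_proj_dual_basis i1'.
have [T0' [b0']] := in_proj_dual_basis i0'.
have [s pes] := projective_cover fQ (dual_basis_generate b0' p'e).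
have i0 := in_proj_psum (map tag s).
set P0 := psum k _ in i0; set p := gen s in pes.
have [T0 [b0]] := in_proj_dual_basis i0.
have fP0 := lfd_in_proj fQ i0.
have [pe _] := pes.
have [K [i [im ip]]] := kernel_exists p.
have [a aE] := in_proj_lift p i0 p'e.
have [b bE] := in_proj_lift p' i0' pe.
have [|k1 k1E] := @kernel_lift _ _ _ _ _ _ i p (rid _ - b ** a) im ip.
  by rewrite rcompBr rcompA bE aE rcomp1 subrr.
have [|k2 k2E] := @kernel_lift _ _ _ _ _ _ i p (b ** f') im ip.
  by rewrite rcompA bE (exact_comp f'p').
(* Write an element n of [K] as (1 - b a) n + b a n. The first term comes from P0 through [k1]; a n
   lies in the kernel of [p'], hence comes from P1', and the second term is reached through [k2]. *)
have Kfg : finitely_generated K.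
  have [bs] := dual_basis_rsum b0 b1.
  apply: (dual_basis_generate bs
    (p := k1 ** rfst P0 P1' + k2 ** rsnd P0 P1')) => x n.
  have /f'p'[m mE] : p' x (a x (i x n)) = 0.
    by rewrite -[LHS]/((p' ** a) x (i x n)) aE; apply/ip; exists n.
  exists (i x n, m); apply: im.
  rewrite -[LHS]/(i x (k1 x (i x n) + k2 x m)) linearD.
  rewrite -[i x (k1 _ _)]/((i ** k1) x (i x n)) k1E.
  rewrite -[i x (k2 _ _)]/((i ** k2) x m) k2E.
  by rewrite -[X in X + _]/(i x n - b x (a x (i x n))) /= mE subrK.
have fK := lfd_mono im fP0.
have pK : is_projective K.
  by apply: hereditary fP0 im _; exact: in_proj_projective.
(* The cover of the projective [K] has a section, which is onto by essentiality: so [K] is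
   isomorphic to its cover. *)
have [s' [qe qess]] := projective_cover fQ Kfg.
have fP1 := lfd_in_proj fQ (in_proj_psum (map tag s')).
have [sg sgE] := pK _ _ _ (rid K) fP1 fK qe.
have sgi : is_iso sg.
  apply: bijective_is_iso.
    by apply: (@rcomp_mono _ _ _ _ _ (gen s')); rewrite sgE => x u v.
  by apply: qess fK _ => x v; exists v; rewrite sgE.
exists K, P0, i, p; split=> //.
by exists (map tag s'), sg.
Qed.

End ProjectiveCovers.

(** * Duality *)

Section ReversePaths.

Fixpoint qpath_rev (Q : quiver) (x y : Q) (r : qpath x y) : @qpath (op Q) y x :=
  match r in qpath _ y return @qpath (op Q) y x with
  | qpath_triv => @qpath_triv (op Q) x
  | qpath_post y z s b => @qpath_pre (op Q) z y b x (qpath_rev s)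
  end.

Lemma qpath_rev_pre (Q : quiver) (x y z : Q) (b : arrow x y) (r : qpath y z) :
  qpath_rev (qpath_pre b r) = @qpath_post (op Q) z y x (qpath_rev r) b.
Proof. by elim: r => //= u v s IH c; rewrite IH. Qed.

Lemma qpath_revK (Q : quiver) (x y : Q) (r : qpath x y) :
  @qpath_rev (op Q) y x (qpath_rev r) = r.
Proof. by elim: r => //= u v s IH c; rewrite qpath_rev_pre IH. Qed.

Lemma existT_inj (A : Type) (B : A -> Type) (x : A) (u v : B x) :
  existT B x u = existT B x v -> u = v.
Proof.
move=> E; have := projT2_eq E.
by rewrite (Prop_irrelevance (projT1_eq E) erefl).
Qed.

(** [F] recovers the last arrow and the path before it, packed with the intermediate vertex on which
    their types depend. *)
Lemma qpath_post_inj (Q : quiver) (x y z : Q) (b : arrow y z) :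
  injective (fun r : qpath x y => qpath_post r b).
Proof.
move=> r s rs.
pose F (q : qpath x z) : option {t : Q & (qpath x t * arrow t z)%type} :=
  match q in qpath _ z return option {t : Q & (qpath x t * arrow t z)%type} with
  | qpath_triv => None
  | qpath_post t _ r' b' => Some (existT _ t (r', b'))
  end.
have E : existT _ y (r, b) = existT _ y (s, b)
    :> {t : Q & (qpath x t * arrow t z)%type}.
  exact: Some_inj (congr1 F rs).
exact: (congr1 fst (existT_inj E)).
Qed.

Lemma qpath_pre_inj (Q : quiver) (x y z : Q) (b : arrow x y) :
  injective (fun r : qpath y z => qpath_pre b r).
Proof.
move=> r s /(congr1 (@qpath_rev Q x z)); rewrite !qpath_rev_pre.
move=> /(@qpath_post_inj (op Q) z y x b) /(congr1 (@qpath_rev (op Q) z y)).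
by rewrite !qpath_revK.
Qed.

Lemma op_interval_finite (Q : quiver) :
  interval_finite Q -> interval_finite (op Q).
Proof.
move=> fQ x y; have /finite_seqP[s sE] := fQ y x.
apply/finite_seqP; exists (map (@qpath_rev Q y x) s).
apply/seteqP; split=> // r _.
apply/mapP; exists (@qpath_rev (op Q) x y r); last by rewrite (@qpath_revK (op Q)).
by have : setT (@qpath_rev (op Q) x y r) by []; rewrite sE.
Qed.

End ReversePaths.

Section Duality.
Context (k : fieldType) (Q : quiver).
Implicit Types M N L X Y Z P : repn k Q.

Lemma drep_map_comp M N L (g : rhom N L) (f : rhom M N) :
  drep_map (g ** f) = drep_map f ** drep_map g.
Proof. by apply: rhom_ext => x t; exact: linear_ext. Qed.

Lemma drep_map_id M : drep_map (rid M) = rid (drep M).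
Proof. by apply: rhom_ext => x t; exact: linear_ext. Qed.

Lemma drep_mapD M N (f g : rhom M N) :
  drep_map (f + g) = drep_map f + drep_map g.
Proof. by apply: rhom_ext => x t; apply: linear_ext => v; exact: linearD. Qed.

Lemma drep_map_is_iso M N (f : rhom M N) : is_iso f -> is_iso (drep_map f).
Proof.
by move=> [g [gf fg]]; exists (drep_map g); rewrite -!drep_map_comp gf fg !drep_map_id.
Qed.

Lemma drep_isomorphic M N : isomorphic M N -> isomorphic (drep M) (drep N).
Proof.
by move=> /isomorphic_sym[f fi]; exists (drep_map f); exact: drep_map_is_iso.
Qed.

Lemma lfd_drep M : lfd M -> lfd (drep M).
Proof. by move=> fM x; exact: fdim_kdual. Qed.

Lemma drep_map_mono M N (f : rhom M N) : is_epi f -> is_mono (drep_map f).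
Proof.
move=> fe x s t st; apply: linear_ext => w; have [v <-] := fe x w.
exact: (congr1 (fun F : kdual (M x) => F v) st).
Qed.

Lemma drep_map_epi M N (f : rhom M N) : lfd N -> is_mono f -> is_epi (drep_map f).
Proof.
move=> fN fm x t; have [r rK] := fdim_retraction (fN x) (fm x).
by exists (kdual_map r t); apply: linear_ext => v; rewrite /= rK.
Qed.

Lemma drep_map_mono_epi M N (f : rhom M N) : lfd N -> is_mono (drep_map f) ->
  is_epi f.
Proof.
move=> fN fm x w; apply: contrapT => nw.
have [|c _ _ [u <-] [v <-]|//|t [tw t0]] :=
  @separation k (N x) (fun w => exists v, f x v = w) w (fN x).
- by exists 0; exact: linear0.
- by exists (c *: u + v); rewrite linearP.
have : drep_map f x t = drep_map f x 0.
  by apply: linear_ext => v; rewrite /= t0 //; exists v.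
by move=> /fm t00; rewrite t00 eqxx in tw.
Qed.

Lemma drep_map_epi_mono M N (f : rhom M N) : lfd M -> is_epi (drep_map f) ->
  is_mono f.
Proof.
move=> fM fe x; apply: raddf_inj => v fv; apply: contrapT.
move=> /(kdual_separates (fM x))[t]; have [s <-] := fe x t.
by rewrite /= fv linear0 eqxx.
Qed.

Lemma drep_map_exact M N L (f : rhom M N) (g : rhom N L) : lfd N -> lfd L ->
  exact_at f g -> exact_at (drep_map g) (drep_map f).
Proof.
move=> fN fL fg x t; split=> [tf|[s <-]].
  have [u gu|s sE] := @factor_linear _ _ _ _ (g x) t (fN x) (fL x).
    have /fg[v <-] := gu.
    exact: (congr1 (fun F : kdual (M x) => F v) tf).
  by exists s; apply: linear_ext.
apply: linear_ext => v.
have /= -> : g x (f x v) = 0 by apply/fg; exists v.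
exact: linear0.
Qed.

Lemma ddual_linear M x : linear (fun v : M x =>
  mklin (f := fun t : kdual (M x) => t v : k^o) (fun c s t => erefl)
  : kdual (kdual (M x))).
Proof. by move=> c u v; apply: linear_ext => t; exact: linearP. Qed.

Program Definition ddual M : rhom M (drep (drep M)) :=
  @RHom k Q M (drep (drep M)) (fun x => mklin (@ddual_linear M x)) _.
Next Obligation. by move=> M x y a v; exact: linear_ext. Qed.

Lemma ddual_natural M N (f : rhom M N) :
  ddual N ** f = drep_map (drep_map f) ** ddual M.
Proof. by apply: rhom_ext => x v; exact: linear_ext. Qed.

Lemma ddual_iso M : lfd M -> is_iso (ddual M).
Proof.
move=> fM; apply: bijective_is_iso => x.
  apply: raddf_inj => v v0; apply: contrapT.
  move=> /(kdual_separates (fM x))[t /eqP]; apply.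
  exact: (congr1 (fun F : kdual (kdual (M x)) => F t) v0).
move=> F; have [v vE] := double_dual F (fM x).
by exists v; apply: linear_ext => t; rewrite vE.
Qed.

(** Dualise [h] once more and identify both ends by biduality. *)
Lemma drep_full M N (h : rhom (drep N) (drep M)) : lfd N ->
  exists f : rhom M N, drep_map f = h.
Proof.
move=> fN; have [e [eK Ke]] := ddual_iso fN.
exists (e ** (drep_map h ** ddual M)).
apply: rhom_ext => x t; apply: linear_ext => v.
have := rhomE ((drep_map h ** ddual M) x v) Ke.
exact: (fun E => congr1 (fun F : kdual (kdual (N x)) => F t) E).
Qed.

Lemma drep_faithful M N (f g : rhom M N) : lfd N ->
  drep_map f = drep_map g -> f = g.
Proof.
move=> fN fg; apply: (mono_cancel (is_iso_mono (ddual_iso fN))).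
by rewrite !ddual_natural fg.
Qed.

Lemma rsum_isomorphic A A' B B' : isomorphic A A' -> isomorphic B B' ->
  isomorphic (@rsum k Q A B) (rsum A' B').
Proof.
move=> [f [f' [ff' f'f]]] [g [g' [gg' g'g]]].
apply: (biprod_isomorphic (i1 := rinl A B ** f') (i2 := rinr A B ** g')
  (p1 := f ** rfst A B) (p2 := g ** rsnd A B)).
- by rewrite -[RHS]f'f; exact: rhom_ext.
- by rewrite -[RHS]g'g; exact: rhom_ext.
- have ffE x v : f' x (f x v) = v := rhomE v ff'.
  have ggE x v : g' x (g x v) = v := rhomE v gg'.
  by apply: rhom_ext => x [u v]; congr (_, _); rewrite /= ?ffE ?ggE ?addr0 ?add0r.
Qed.

Lemma is_zero_isomorphic M N : is_zero M -> is_zero N -> isomorphic M N.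
Proof.
by move=> M0 N0; exists 0, 0; split; apply: rhom_ext => x v;
  [rewrite [RHS]M0|rewrite [RHS]N0].
Qed.

Lemma is_zero_rzero : is_zero (rzero k Q).
Proof. by move=> x v; exact: thinmx0. Qed.

Lemma drep_rsum A B : isomorphic (drep (@rsum k Q A B)) (rsum (drep A) (drep B)).
Proof.
apply: (biprod_isomorphic (i1 := drep_map (rfst A B)) (i2 := drep_map (rsnd A B))
  (p1 := drep_map (rinl A B)) (p2 := drep_map (rinr A B))).
- by rewrite -drep_map_comp -drep_map_id; congr drep_map; exact: rhom_ext.
- by rewrite -drep_map_comp -drep_map_id; congr drep_map; exact: rhom_ext.
- by rewrite -!drep_map_comp -drep_mapD rsum_biprod drep_map_id.
Qed.

Lemma drep_is_zero M : is_zero M -> is_zero (drep M).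
Proof. by move=> M0 x t; apply: linear_ext => v; rewrite (M0 x v) !linear0. Qed.

Lemma is_zero_drep M : lfd M -> is_zero (drep M) -> is_zero M.
Proof.
move=> fM M0 x v; apply: contrapT => /(kdual_separates (fM x))[t].
by rewrite (M0 x t) eqxx.
Qed.

Lemma in_proj_isomorphic M N : isomorphic M N -> in_proj N -> in_proj M.
Proof. by move=> MN [s Ns]; exists s; exact: isomorphic_trans Ns. Qed.

Lemma in_inj_isomorphic M N : isomorphic M N -> in_inj N -> in_inj M.
Proof. by move=> MN [s Ns]; exists s; exact: isomorphic_trans Ns. Qed.

Lemma in_proj_cons (a : Q) M N : isomorphic M (proj_rep k a) -> in_proj N ->
  in_proj (rsum M N).
Proof. by move=> Ma [s Ns]; exists (a :: s); exact: rsum_isomorphic. Qed.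

Lemma in_inj_cons (a : Q) M N : isomorphic M (inj_rep k a) -> in_inj N ->
  in_inj (rsum M N).
Proof. by move=> Ma [s Ns]; exists (a :: s); exact: rsum_isomorphic. Qed.

Lemma in_proj_zero M : is_zero M -> in_proj M.
Proof. by exists [::]; apply: is_zero_isomorphic => //; exact: is_zero_rzero. Qed.

Lemma in_inj_zero M : is_zero M -> in_inj M.
Proof. by exists [::]; apply: is_zero_isomorphic => //; exact: is_zero_rzero. Qed.

(* P_a for the opposite quiver, with paths written in Q. *)
Definition copaths (a : Q) : repn k (op Q) :=
  @Repn k (op Q) (fun x => {freeg (@qpath Q x a) / k})
    (fun y x (b : @arrow Q x y) => linear_extension (fun r : @qpath Q y a =>
       << qpath_pre b r >> : {freeg (@qpath Q x a) / k})).

Lemma copaths_proj_rep (a : Q) : isomorphic (copaths a) (@proj_rep k (op Q) a).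
Proof.
pose F (x : op Q) : {linear copaths a x -> @proj_rep k (op Q) a x} :=
  linear_extension (fun r : @qpath Q x a =>
    << qpath_rev r >> : {freeg (@qpath (op Q) a x) / k}).
have FA (y x : op Q) (b : arrow y x) v :
    F x (act (copaths a) b v) = act (@proj_rep k (op Q) a) b (F y v).
  pose A := act (copaths a) b; pose B := act (@proj_rep k (op Q) a) b.
  change ((F x \o A) v = (B \o F y) v); apply: freeg_linear_ext => r.
  by rewrite /F /A /B /= !(liftU, scale1r) qpath_rev_pre.
pose G (x : op Q) : {linear @proj_rep k (op Q) a x -> copaths a x} :=
  linear_extension (fun r : @qpath (op Q) a x =>
    << @qpath_rev (op Q) a x r >> : {freeg (@qpath Q x a) / k}).
exists (RHom FA); apply: bijective_is_iso => x.
  apply: (can_inj (g := G x)) => v /=; change ((G x \o F x) v = idfun v).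
  apply: freeg_linear_ext => r.
  by rewrite /F /G /= !(liftU, scale1r) qpath_revK.
move=> v; exists (G x v); change ((F x \o G x) v = idfun v).
apply: freeg_linear_ext => r.
by rewrite /F /G /= !(liftU, scale1r) (@qpath_revK (op Q)).
Qed.

(** Yoneda: Hom(P_a, P_x) = P_x(a), with basis the paths from [x] to [a]. *)
Lemma hom_to_A_proj_rep (a : Q) :
  isomorphic (hom_to_A (proj_rep k a)) (copaths a).
Proof.
have H (x : op Q) :
  linear (fun h : rhom (proj_rep k a) (proj_rep k (x : Q)) => h a (triv k a)).
  by [].
pose F : rhom (hom_to_A (proj_rep k a)) (copaths a) :=
  @RHom k (op Q) (hom_to_A (proj_rep k a)) (copaths a) (fun x => mklin (H x))
    (fun y x b h => erefl).
exists F; apply: bijective_is_iso => x.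
  by move=> g h gh; exact: (@yoneda_ext k Q (@proj_rep k Q x) a g h gh).
move=> v; exists (@yoneda k Q (@proj_rep k Q x) a v).
exact: (@yoneda_triv k Q (@proj_rep k Q x) a v).
Qed.

Lemma coeff_linear (K : choiceType) (r : K) :
  linear (fun D : {freeg K / k} => coeff r D : k^o).
Proof. by move=> c u v; rewrite coeffD coeffZ. Qed.

(** A path in I_a(x) is sent to its coefficient functional. Cutting [b] off a path is the transpose
    of prepending [b], and since the paths from [x] to [a] are finite in number these functionals
    span the dual. *)
Lemma inj_rep_copaths (a : Q) : interval_finite Q ->
  isomorphic (inj_rep k a) (drep (copaths a)).
Proof.
move=> fQ.
pose F (x : Q) : {linear inj_rep k a x -> kdual {freeg (@qpath Q x a) / k}} :=
  linear_extension (fun r : @qpath Q x a => mklin (@coeff_linear (qpath x a) r)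
    : kdual {freeg (@qpath Q x a) / k}).
have FE (x : Q) (D : inj_rep k a x) (r : qpath x a) :
    (F x D : kdual _) << r >> = coeff r D.
  have H : linear (fun D => (F x D : kdual _) << r >> : k^o).
    by move=> c u v; rewrite linearP.
  change (mklin H D = mklin (@coeff_linear (qpath x a) r) D).
  apply: freeg_linear_ext => s.
  by rewrite /= liftU scale1r /= !coeffU eq_sym.
have FA (x y : Q) (b : arrow x y) v :
    F y (act (inj_rep k a) b v) = act (drep (copaths a)) b (F x v).
  pose A := act (inj_rep k a) b; pose B := act (drep (copaths a)) b.
  change ((F y \o A) v = (B \o F x) v); apply: freeg_linear_ext => s.
  apply: linear_ext; apply: freeg_linear_ext => r.
  rewrite -[LHS]/((F y (A << s >>) : kdual _) << r >>) FE.
  rewrite -[RHS]/((F x << s >> : kdual _) (act (copaths a) b << r >>)).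
  have -> : act (copaths a) b << r >> = << qpath_pre b r >>.
    by rewrite /= liftU scale1r.
  rewrite FE coeffU mul1r.
  have -> : A << s >> = qpath_cut k b s by rewrite /A /= liftU scale1r.
  rewrite /qpath_cut; case: pselect => [e|ne].
    case: (cid e) => r' /= <-; rewrite coeffU mul1r.
    by rewrite (inj_eq (@qpath_pre_inj Q x y a b)).
  rewrite coeff0; case: eqP => // sE; case: ne; by exists r.
exists (@RHom k Q (inj_rep k a) (drep (copaths a)) F FA).
apply: bijective_is_iso => x.
  move=> D E DE; apply/eqP/freeg_eqP => r; rewrite -!FE.
  exact: (congr1 (fun G : kdual _ => G << r >>) DE).
move=> G; have /finite_seqP[s sE] := fQ x a.
exists (\sum_(r <- undup s) (G << r >> : k) *: << r >>).
apply: linear_ext; apply: freeg_linear_ext => r.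
rewrite -[LHS]/((F x _ : kdual _) << r >>) FE (raddf_sum (coeff r)).
have rs : r \in undup s.
  by rewrite mem_undup; have : setT r by []; rewrite sE.
rewrite (bigD1_seq r) ?undup_uniq //= coeffZ coeffU eqxx !mulr1.
rewrite big1 ?addr0 // => q /negPf qr.
by rewrite coeffZ coeffU qr !mulr0.
Qed.

End Duality.

(** * Exchange of projectives and injectives under D *)

Section DualProjInj.
Context (k : fieldType) (Q : quiver).
Implicit Types M N L X Y Z P I : repn k Q.

Lemma nakayama_mapD M N (f g : rhom M N) :
  nakayama_map (f + g) = nakayama_map f + nakayama_map g.
Proof.
apply: rhom_ext => x z; apply: linear_ext => h.
rewrite -[LHS]/((z : kdual _) (h ** (f + g))).
have -> : h ** (f + g) = h ** f + h ** g.
  by apply: rhom_ext => y v; exact: linearD.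
by rewrite linearD.
Qed.

Lemma nakayama_rsum A B :
  isomorphic (nakayama (@rsum k Q A B)) (rsum (nakayama A) (nakayama B)).
Proof.
apply: (biprod_isomorphic (i1 := nakayama_map (rinl A B))
  (i2 := nakayama_map (rinr A B)) (p1 := nakayama_map (rfst A B))
  (p2 := nakayama_map (rsnd A B))).
- by rewrite -nakayama_map_comp -nakayama_map_id; congr nakayama_map; exact: rhom_ext.
- by rewrite -nakayama_map_comp -nakayama_map_id; congr nakayama_map; exact: rhom_ext.
- by rewrite -!nakayama_map_comp -nakayama_mapD rsum_biprod nakayama_map_id.
Qed.

Lemma nakayama_isomorphic M N : isomorphic M N ->
  isomorphic (nakayama M) (nakayama N).
Proof.
move=> [f [g [gf fg]]]; exists (nakayama_map f), (nakayama_map g).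
by rewrite -!nakayama_map_comp gf fg !nakayama_map_id.
Qed.

(** By additivity it is enough that nu P_a = D Hom(P_a, A) is I_a. *)
Lemma nakayama_in_inj P : interval_finite Q -> in_proj P -> in_inj (nakayama P).
Proof.
move=> fQ [s /nakayama_isomorphic Ps]; apply: in_inj_isomorphic Ps _.
elim: s => [|a s IH].
  apply: in_inj_zero => x t; apply: linear_ext => h.
  have -> : h = 0 by apply: rhom_ext => y v; rewrite [v]thinmx0 !linear0.
  by rewrite !linear0.
apply: in_inj_isomorphic (nakayama_rsum _ _) _; apply: (@in_inj_cons _ _ a) IH.
apply: isomorphic_trans (isomorphic_sym (inj_rep_copaths k a fQ)).
exact: drep_isomorphic (hom_to_A_proj_rep k a).
Qed.

Lemma drep_in_inj P : interval_finite Q -> in_proj P -> in_inj (drep P).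
Proof.
move=> fQ [s /drep_isomorphic Ps]; apply: in_inj_isomorphic Ps _.
elim: s => [|a s IH].
  by apply: in_inj_zero; apply: drep_is_zero; exact: is_zero_rzero.
apply: in_inj_isomorphic (drep_rsum _ _) _; apply: (@in_inj_cons k (op Q) a _ _ _ IH).
apply: isomorphic_trans (isomorphic_sym
  (@inj_rep_copaths k (op Q) a (op_interval_finite fQ))).
exact: isomorphic_sym (drep_isomorphic (@copaths_proj_rep k (op Q) a)).
Qed.

Lemma drep_in_proj I : interval_finite Q -> in_inj I -> in_proj (drep I).
Proof.
move=> fQ [s /drep_isomorphic Is]; apply: in_proj_isomorphic Is _.
elim: s => [|a s IH].
  by apply: in_proj_zero; apply: drep_is_zero; exact: is_zero_rzero.
apply: in_proj_isomorphic (drep_rsum _ _) _; apply: (@in_proj_cons k (op Q) a _ _ _ IH).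
apply: isomorphic_trans (copaths_proj_rep k a).
apply: isomorphic_trans (drep_isomorphic (inj_rep_copaths k a fQ)) _.
apply: isomorphic_sym; exists (ddual (copaths k a)); apply: ddual_iso => x.
exact: (@fdim_freeg k _ (fQ x a)).
Qed.

Lemma lfd_in_inj I : interval_finite Q -> in_inj I -> lfd I.
Proof.
move=> fQ [s /lfd_isomorphic]; apply; elim: s => [|a s IH]; first exact: lfd_rzero.
by apply: lfd_rsum => // x; exact: (@fdim_freeg k _ (fQ x a)).
Qed.

Lemma lfd_nakayama_inv I : interval_finite Q -> in_inj I -> lfd (nakayama_inv I).
Proof.
move=> fQ iI x; apply: fdim_rhom; first exact: drep_in_proj.
by apply: lfd_proj_rep; exact: op_interval_finite.
Qed.

Lemma drep_indecomposable M : lfd M -> indecomposable M -> indecomposable (drep M).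
Proof.
move=> fM [nM iM]; split; first by move/(is_zero_drep fM).
move=> M1 M2 f1 f2 /drep_isomorphic MM.
(* The ascriptions read representations of [op (op Q)] as representations of the convertible quiver
   [Q]. *)
have E : @isomorphic k Q (drep (rsum M1 M2)) (rsum (drep M1) (drep M2)) :=
  drep_rsum M1 M2.
have {}MM : @isomorphic k Q (drep (drep M)) (drep (rsum M1 M2)) := MM.
have ddM : isomorphic M (drep (drep M)) by exists (ddual M); exact: ddual_iso.
have := isomorphic_trans ddM (isomorphic_trans MM E).
case/(iM _ _ (lfd_drep f1) (lfd_drep f2)).
  by move/(is_zero_drep f1); left.
by move/(is_zero_drep f2); right.
Qed.

Lemma drep_not_projective M : lfd M -> ~ is_injective M -> ~ is_projective (drep M).
Proof.
move=> fM nM pM; apply: nM => X Y i f fX fY im.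
have [h hE] := pM _ _ (drep_map i) (drep_map f) (lfd_drep fY) (lfd_drep fX)
  (drep_map_epi fY im).
have [g gE] := drep_full h fM; exists g; apply: (drep_faithful fM).
by rewrite drep_map_comp gE.
Qed.

Lemma drep_in_rep_plus M : interval_finite Q -> lfd M -> in_rep_minus M ->
  in_rep_plus (drep M).
Proof.
move=> fQ fM [I0 [I1 [j [g [i0 i1 [jm jg ge]]]]]].
have f0 := lfd_in_inj fQ i0; have f1 := lfd_in_inj fQ i1.
exists (drep I1), (drep I0), (drep_map g), (drep_map j).
split; try exact: drep_in_proj.
split; first exact: drep_map_mono; first exact: drep_map_exact.
exact: drep_map_epi.
Qed.

(** D is an exact duality, so it exchanges the left and right conditions. A test object [Z] over the
    opposite quiver is replaced by D Z, and the factorisation found there is brought back by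
    biduality. *)
Lemma drep_almost_split A B C (f : rhom A B) (g : rhom B C) :
  almost_split_sequence f g -> @almost_split_sequence k (op Q) _ _ _ (drep_map g) (drep_map f).
Proof.
move=> [[fA fB fC] [fm fg ge] [lf [nf af]] [rg [ng ag]]].
split; first by split; exact: lfd_drep.
- split; [exact: drep_map_mono|exact: drep_map_exact|exact: drep_map_epi].
- split.
    move=> h; have [h' <-] := drep_full h fB.
    by rewrite -drep_map_comp => /(drep_faithful fC)/rg; exact: drep_map_is_iso.
  split=> [[r]|Z t fZ nt].
    have [s <-] := drep_full r fB; rewrite -drep_map_comp -drep_map_id.
    by move=> /(drep_faithful fC) E; apply: ng; exists s.
  have [e [eK _]] := ddual_iso fZ.
  have [t' t'E] := @drep_full k Q (drep Z) C (ddual Z ** t) fC.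
  have [|h hE] := ag _ t' (lfd_drep fZ : @lfd k Q _).
    case=> s ts; apply: nt; exists (@drep_map k Q _ _ s ** ddual Z).
    by rewrite -rcompA -t'E -drep_map_comp ts drep_map_id.
  exists (e ** @drep_map k Q _ _ h).
  by rewrite -rcompA -drep_map_comp hE t'E rcompA eK rcomp1l.
- split.
    move=> h; have [h' <-] := drep_full h fB.
    by rewrite -drep_map_comp => /(drep_faithful fB)/lf; exact: drep_map_is_iso.
  split=> [[r]|Z t fZ nt].
    have [s <-] := drep_full r fA; rewrite -drep_map_comp -drep_map_id.
    by move=> /(drep_faithful fA) E; apply: nf; exists s.
  have [e [eK Ke]] := ddual_iso fZ.
  have [t' t'E] := @drep_full k Q A (drep Z) (t ** e) (lfd_drep fZ : @lfd k Q _).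
  have [|h hE] := af _ t' (lfd_drep fZ : @lfd k Q _).
    case=> s ts; apply: nt; exists (e ** @drep_map k Q _ _ s).
    by rewrite rcompA -t'E -drep_map_comp ts drep_map_id.
  exists (@drep_map k Q _ _ h ** ddual Z).
  by rewrite rcompA -drep_map_comp hE t'E -rcompA eK rcomp1.
Qed.

(** Serves to replace double duals by the original representations at the ends of the sequence. *)
Lemma almost_split_iso A A' B C C' (f : rhom A B) (g : rhom B C)
    (al : rhom A' A) (be : rhom C C') : is_iso al -> is_iso be ->
  almost_split_sequence f g -> @almost_split_sequence k Q _ _ _ (f ** al) (be ** g).
Proof.
move=> [al' [al'al alal']] [be' [be'be bebe']].
have ali : is_iso al by exists al'.
have bei : is_iso be by exists be'.
move=> [[fA fB fC] [fm fg ge] [lf [nf af]] [rg [ng ag]]].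
have fK : f ** al ** al' = f by rewrite -rcompA alal' rcomp1.
have gK : be' ** (be ** g) = g by rewrite rcompA be'be rcomp1l.
split.
- split=> //; first exact: lfd_mono (is_iso_mono ali) fA.
  exact: lfd_epi (is_iso_epi bei) fC.
- split; first by apply: mono_rcomp => //; exact: is_iso_mono.
    move=> x w; split=> [gw|[v <-]].
      have /fg[v <-] : g x w = 0.
        by apply: (is_iso_mono bei); rewrite linear0.
      have [u <-] := is_iso_epi ali v; by exists u.
    have /= -> : g x (f x (al x v)) = 0 by apply/fg; exists (al x v).
    exact: linear0.
  by apply: epi_rcomp => //; exact: is_iso_epi.
- split; first by move=> h hf; apply: lf; rewrite -fK rcompA hf.
  split=> [[r rf]|Z t fZ nt].
    have E : r ** f = al' by rewrite -fK !rcompA -(rcompA r f) rf rcomp1l.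
    by apply: nf; exists (al ** r); rewrite -rcompA E.
  have [|h hE] := af Z (t ** al') fZ.
    case=> r rt; apply: nt; exists (al' ** r); rewrite -rcompA.
    have -> : r ** t = al.
      by rewrite -[LHS]rcomp1 -al'al !rcompA -(rcompA r t al') rt rcomp1l.
    exact: al'al.
  by exists h; rewrite rcompA hE -rcompA al'al rcomp1.
- split; first by move=> h hg; apply: rg; rewrite -gK -rcompA hg.
  split=> [[r gr]|Z t fZ nt].
    have E : g ** r = be' by rewrite -gK -!rcompA (rcompA be) gr rcomp1.
    by apply: ng; exists (r ** be); rewrite rcompA E.
  have [|h hE] := ag Z (be' ** t) fZ.
    case=> r tr; apply: nt; exists (r ** be'); rewrite rcompA.
    have -> : t ** r = be by rewrite -[t]rcomp1l -bebe' -!rcompA (rcompA be') tr rcomp1.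
    exact: bebe'.
  by exists h; rewrite -rcompA hE rcompA bebe' rcomp1l.
Qed.

End DualProjInj.

(** * The translates DTr and TrD, and the two parts of the theorem *)

Section MainTheorem.
Context (k : fieldType) (Q : quiver).
Implicit Types M N L X Y Z P I : repn k Q.

Lemma DTr_exists M : interval_finite Q -> lfd M -> in_rep_plus M ->
  exists X, is_DTr M X.
Proof.
move=> fQ fM pM.
have [P1 [P0 [f [p fp]]]] := minimal_proj_resolution_exists fQ fM pM.
have [X [i ik]] := kernel_exists (nakayama_map f).
by exists X, P1, P0, f, p, i.
Qed.

Lemma DTr_sequence M X : interval_finite Q -> lfd M -> indecomposable M ->
  ~ is_projective M -> is_DTr M X ->
  in_rep_minus X /\ exists N (f : rhom X N) (g : rhom N M),
    almost_split_sequence f g.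
Proof.
move=> fQ fM iM nM [P1 [P0 [f [p [i [fp ik]]]]]]; split; last first.
  exact: DTr_almost_split fQ fM iM nM fp ik.
have [i1 i0 _ _] := fp.
exists (nakayama P1), (nakayama P0), i, (nakayama_map f).
split; try exact: nakayama_in_inj.
exact: DTr_short_exact fQ fM iM nM fp ik.
Qed.

(** Provides the cokernel defining TrD as the dual of a kernel. *)
Lemma kernel_drep_cokernel A B (Y : repn k (op Q)) (f : rhom A B)
    (i : rhom Y (drep B)) : lfd A -> lfd B ->
  is_kernel i (drep_map f) ->
  @is_cokernel k Q A B (drep Y) f (@drep_map k (op Q) Y (drep B) i ** ddual B).
Proof.
move=> fA fB [im ie].
have fdA := lfd_drep fA; have fdB := lfd_drep fB.
have die := drep_map_exact fdB fdA ie.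
have dBi := ddual_iso fB; have dAi := ddual_iso fA.
split.
  move=> x w; split=> [iw|[v <-]].
    have /die[v' v'E] := iw; have [v vE] := is_iso_epi dAi v'.
    exists v; apply: (is_iso_mono dBi).
    by rewrite -v'E -vE; exact: (rhomE v (ddual_natural f)).
  by apply/die; exists (ddual A x v); exact: (esym (rhomE v (ddual_natural f))).
have die' := drep_map_epi fdB im.
by move=> x t; have [s <-] := die' x t; have [w <-] := is_iso_epi dBi s; exists w.
Qed.

Lemma minimal_inj_coresolution_exists M : interval_finite Q -> lfd M ->
  in_rep_minus M ->
  exists I0 I1 (j : rhom M I0) (g : rhom I0 I1), minimal_inj_coresolution j g.
Proof.
move=> fQ fM mM; have oQ := op_interval_finite fQ.
have fdM := lfd_drep fM.
have [P1 [P0 [f [p [i1 i0 [fm fp pe] [_ pess]]]]]] :=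
  minimal_proj_resolution_exists oQ fdM (drep_in_rep_plus fQ fM mM).
have f0 := lfd_in_proj oQ i0; have f1 := lfd_in_proj oQ i1.
have ddM := ddual_iso fM.
pose I0 : repn k Q := drep P0; pose I1 : repn k Q := drep P1.
pose j : rhom M I0 := @drep_map k (op Q) P0 (drep M) p ** ddual M.
pose g : rhom I0 I1 := @drep_map k (op Q) P1 P0 f.
have jm : is_mono j.
  by apply: mono_rcomp; [exact: (drep_map_mono pe)|exact: is_iso_mono].
exists I0, I1, j, g; split.
- exact: (drep_in_inj oQ i0).
- exact: (drep_in_inj oQ i1).
- split=> //; last exact: (drep_map_epi f0 fm).
  have dfp := drep_map_exact f0 fdM fp.
  move=> x w; split=> [/dfp[t <-]|[v <-]].
    by have [v <-] := is_iso_epi ddM t; exists v.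
  by apply/dfp; exists (ddual M x v).
split=> // X h fX hjm.
have [e [eK Ke]] := ddual_iso f0.
(* Up to biduality D h is a morphism h' : D X -> P0, and [p h'] is the dual of the monomorphism
   [h j], hence epi. Essentiality of [p] makes h' epi; then D h is epi and [h] mono. *)
pose dh : rhom (drep X) (drep I0) := drep_map h.
pose h' : rhom (drep X) P0 := e ** dh.
have h'E : ddual P0 ** h' = dh by rewrite rcompA Ke rcomp1l.
have key x (s : drep X x) (t : I0 x) : (t : kdual (P0 x)) (h' x s) = (s : kdual (X x)) (h x t).
  exact: (congr1 (fun F : kdual (kdual (P0 x)) => F t) (rhomE s h'E)).
have ph'e : is_epi (p ** h').
  apply: (drep_map_mono_epi fdM) => x; apply: raddf_inj => u u0.
  have [v vE] := is_iso_epi ddM u; rewrite -vE.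
  suff -> : v = 0 by rewrite linear0.
  apply: hjm; rewrite linear0; apply: (is_iso_mono (ddual_iso fX)).
  rewrite linear0; apply: linear_ext => s; rewrite /= -key.
  by rewrite -vE in u0; exact: (congr1 (fun F : kdual (drep X x) => F s) u0).
have h'e := pess _ _ (lfd_drep fX) ph'e.
have dhe : is_epi dh.
  by rewrite -h'E; apply: epi_rcomp => //; exact: (is_iso_epi (ddual_iso f0)).
exact: (drep_map_epi_mono (lfd_drep f0 : @lfd k Q I0) dhe).
Qed.

Lemma TrD_exists M : interval_finite Q -> lfd M -> in_rep_minus M ->
  exists X, is_TrD M X.
Proof.
move=> fQ fM mM.
have [I0 [I1 [j [g jg]]]] := minimal_inj_coresolution_exists fQ fM mM.
have [i0 i1 _ _] := jg.
have [Y [i ik]] := kernel_exists (drep_map (nakayama_inv_map g)).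
have ck := kernel_drep_cokernel (lfd_nakayama_inv fQ i0) (lfd_nakayama_inv fQ i1) ik.
by exists (drep Y), I0, I1, j, g; eexists; split; [exact: jg|exact: ck].
Qed.

Lemma lfd_TrD M X : interval_finite Q -> is_TrD M X -> lfd X.
Proof.
move=> fQ [I0 [I1 [j [g [q [[i0 i1 _ _] [_ qe]]]]]]].
exact: lfd_epi qe (lfd_nakayama_inv fQ i1).
Qed.

(** [nakayama (drep I)] and [drep (nakayama_inv I)] agree by definition, so D turns the cokernel of
    nu^-(g) into the kernel of nu(D g). The dual of the coresolution is a minimal resolution of D M,
    essentiality being transposed through biduality. *)
Lemma drep_TrD M X : interval_finite Q -> lfd M -> is_TrD M X ->
  is_DTr (drep M) (drep X).
Proof.
move=> fQ fM TX; have fX := lfd_TrD fQ TX.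
have [I0 [I1 [j [g [q [[i0 i1 [jm jg ge] [_ jess]] [gq qe]]]]]]] := TX.
have f0 := lfd_in_inj fQ i0; have f1 := lfd_in_inj fQ i1.
have fdM := lfd_drep fM.
exists (drep I1), (drep I0), (drep_map g), (drep_map j), (drep_map q); split; last first.
  split; first exact: drep_map_mono.
  exact: (drep_map_exact (lfd_nakayama_inv fQ i1) fX gq).
have dje : is_epi (drep_map j) by exact: drep_map_epi.
split; try exact: drep_in_proj.
  split; [exact: drep_map_mono|exact: drep_map_exact|done].
split=> // X' h fX' jhe.
pose h' : rhom I0 (drep X') := @drep_map k (op Q) X' (drep I0) h ** ddual I0.
have h'm : is_mono h'.
  apply: (jess _ _ (lfd_drep fX' : @lfd k Q (drep X'))) => x.
  apply: raddf_inj => v v0; apply: contrapT.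
  move=> /(kdual_separates (fM x))[t /eqP]; apply.
  have [s <-] := jhe x t.
  exact: (congr1 (fun F : kdual (X' x) => F s) v0).
apply: (drep_map_mono_epi (lfd_drep f0)) => x.
apply: raddf_inj => u u0; have [v vE] := is_iso_epi (ddual_iso f0) u.
rewrite -vE; suff -> : v = 0 by rewrite linear0.
by apply: h'm; rewrite linear0 -[LHS]/(drep_map h x (ddual I0 x v)) vE.
Qed.

End MainTheorem.

Theorem theorem2p8 (k : fieldType) (Q : quiver) (M : repn k Q)
  (hQ : strongly_locally_finite Q) (hM : lfd M) (hMi : indecomposable M) :
  (in_rep_plus M -> ~ is_projective M ->
     (exists X : repn k Q, is_DTr M X) /\
     (forall X : repn k Q, is_DTr M X ->
        in_rep_minus X /\
        exists (N : repn k Q) (f : rhom X N) (g : rhom N M),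
          almost_split_sequence f g)) /\
  (in_rep_minus M -> ~ is_injective M ->
     (exists X : repn k Q, is_TrD M X) /\
     (forall X : repn k Q, is_TrD M X ->
        in_rep_plus X /\
        exists (N : repn k Q) (f : rhom M N) (g : rhom N X),
          almost_split_sequence f g)).
Proof.
have [_ fQ] := hQ; split=> [pM nM|mM nM].
  by split=> [|X]; [exact: DTr_exists|exact: DTr_sequence].
split=> [|X TX]; first exact: TrD_exists.
have oQ := op_interval_finite fQ; have fX := lfd_TrD fQ TX.
(* The first part over the opposite quiver, for D M and its translate D X; dualising the result
   gives a sequence from D D M to D D X. *)
have [[J0 [J1 [i [g [i0 i1 ig]]]]] [N [f [h fh]]]] :=
  DTr_sequence oQ (lfd_drep hM) (drep_indecomposable hM hMi)
    (drep_not_projective hM nM) (drep_TrD fQ hM TX).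
have [im ige ge] := ig.
have f0 := lfd_in_inj oQ i0; have f1 := lfd_in_inj oQ i1.
have ddX := ddual_iso fX; have [e [eK Ke]] := ddX.
have ei : is_iso e by exists (ddual X).
split; last first.
  exists (drep N), (@drep_map k (op Q) _ _ h ** ddual M),
    (e ** @drep_map k (op Q) _ _ f).
  apply: almost_split_iso; [exact: ddual_iso|exact: ei|].
  exact: (drep_almost_split fh).
exists (drep J1), (drep J0), (@drep_map k (op Q) _ _ g),
  (e ** @drep_map k (op Q) _ _ i).
split; [exact: (drep_in_proj oQ i1)|exact: (drep_in_proj oQ i0)|].
have dig := drep_map_exact f0 f1 ige.
split; first exact: (drep_map_mono ge).
  move=> x w; rewrite -[X in X <-> _]/(e x (drep_map i x w) = 0) -dig.
  split=> [E|->]; last exact: linear0.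
  by apply: (is_iso_mono ei); rewrite linear0.
by apply: epi_rcomp; [exact: is_iso_epi|exact: (drep_map_epi f0 im)].
Qed.
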